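(* For every $k,l\ge2$, all $n\ge1$ and $0\le t<1/n$, $$\operatorname{Cov}\bigl(S_k(t),S_l(t)\bigr)=n\,P_{k,l}\Bigl(\frac1{1-nt}\Bigr)+O\Bigl(\frac{nt}{(1-nt)^{2k+2l}}\Bigr),$$ where $P_{k,l}$ is a polynomial of degree $2k+2l-3$ given by $$P_{k,l}(x)=p_{k+l}(x)-\frac{p_{k+1}(x)\,p_{l+1}(x)}{x}.$$
   Context: The random graph process $\mathcal G(n,t)$, $t\ge0$, starts at $t=0$ with $n$ vertices and no edges, and each of the $\binom n2$ possible edges is added independently at an exponentially distributed time with mean $1$; thus $\mathcal G(n,t)$ has the distribution of $G(n,1-e^{-t})$. For a graph $G$ with connected components $\mathcal C_1,\dots,\mathcal C_K$, $S_k(G)=\sum_{i=1}^K|\mathcal C_i|^k$, and $S_k(t)=S_k(\mathcal G(n,t))$. The polynomials $p_k$, $k\ge2$, are given by $p_2(x)=x$ and, for $k\ge3$, $p_k(x)=x^kq_k(x)$, where $q_k$ is the polynomial defined recursively by $q_k(1)=1$ and $q_k'(x)=\frac12\sum_{l=2}^{k-2}\binom kl q_{l+1}(x)q_{k-l+1}(x)$. The constant implicit in $O$ may depend on $k,l$ but not on $n$ or $t$ in the given range. *)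

(* Defs.v *)
From HB Require Import structures.
From mathcomp Require Import all_boot all_order all_algebra.
From mathcomp Require Import all_classical all_reals all_analysis.
From mathcomp Require Import zify.

Set Implicit Arguments.
Unset Strict Implicit.
Unset Printing Implicit Defensive.

Import Order.TTheory GRing.Theory Num.Theory.
Local Open Scope ring_scope.

Section Polynomials.
Variable R : numFieldType.
Implicit Type f : {poly R}.

Definition antideriv f : {poly R} :=
  'X * \poly_(i < size f) (f`_i / i.+1%:R).

Lemma deriv_antideriv f : (antideriv f)^`() = f.
Proof.
apply/polyP => i; rewrite coef_deriv /antideriv coefXM /= coef_poly.
case: ltnP => [_|le_i]; last by rewrite mul0rn nth_default.
by rewrite -[LHS]mulr_natr divfK // pnatr_eq0.
Qed.

Definition q_rhs (q : nat -> {poly R}) (k : nat) : {poly R} :=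
  2^-1 *: \sum_(2 <= l < k.-1) 'C(k, l)%:R *: (q l.+1 * q (k - l).+1).

(* The recursion is on the fuel [m]; [q_rec m k] does not depend on [m] once
   [k <= m], and [q_horner1], [deriv_q] below show that [q_poly] satisfies
   the two defining equations of q_k. *)
Fixpoint q_rec (m k : nat) : {poly R} :=
  if m is m'.+1 then
    let F := antideriv (q_rhs (q_rec m') k) in F + (1 - F.[1])%:P
  else 1.

Definition q_poly (k : nat) : {poly R} := q_rec k k.

Lemma q_rec_fuel m k : (k <= m)%N -> q_rec m k = q_poly k.
Proof.
rewrite /q_poly; elim/ltn_ind: k m => k IHk [|m]; first by rewrite leqn0 => /eqP->.
case: k IHk => [|k] IHk le_km.
  by rewrite /= /q_rhs big_geq // scaler0 /antideriv size_poly0 poly_def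
             big_ord0 mulr0 horner0 subr0 add0r.
rewrite /=; suff -> : q_rhs (q_rec m) k.+1 = q_rhs (q_rec k) k.+1 by [].
rewrite /q_rhs; congr (_ *: _); apply: eq_big_nat => l /andP[l2 /= lk].
have l_lt : (l.+1 < k.+1)%N by lia.
have kl_lt : ((k.+1 - l).+1 < k.+1)%N by lia.
by rewrite !(IHk l.+1) ?(IHk (k.+1 - l).+1) //; lia.
Qed.

Lemma q_horner1 k : (q_poly k).[1] = 1.
Proof.
case: k => [|k]; first by rewrite hornerC.
by rewrite /q_poly /= hornerD hornerC addrC subrK.
Qed.

Lemma deriv_q k : (3 <= k)%N ->
  (q_poly k)^`() =
  2^-1 *: \sum_(2 <= l < k.-1) 'C(k, l)%:R *: (q_poly l.+1 * q_poly (k - l).+1).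
Proof.
case: k => // k _; rewrite {1}/q_poly /= derivD derivC addr0 deriv_antideriv.
rewrite /q_rhs; congr (_ *: _); apply: eq_big_nat => l /andP[l2 /= lk].
by rewrite !q_rec_fuel //; lia.
Qed.

(* Meaningful for [2 <= k] only. *)
Definition p_poly (k : nat) : {poly R} :=
  if k == 2%N then 'X else 'X^k * q_poly k.

End Polynomials.

Section ComponentSums.
Variable V : finType.

(* [connect g] is an equivalence relation when [g] is symmetric. *)
Definition components (g : rel V) : {set {set V}} :=
  equivalence_partition (connect g) [set: V].

Definition comp_sum (k : nat) (g : rel V) : nat :=
  (\sum_(C in components g) #|C| ^ k)%N.

End ComponentSums.

Definition pair_of (n : nat) := {e : {set 'I_n} | #|e| == 2%N}.

Section Process.
Context {d : measure_display} {Omega : measurableType d} {R : realType}.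
Variable P : probability Omega R.

Definition mutually_independent (I : finType) (X : I -> {RV P >-> R}) :=
  forall (J : {set I}) (B : I -> set R),
    (forall i, measurable (B i)) ->
    P (\bigcap_(i in [set` J]) (X i @^-1` B i))%classic =
    (\prod_(i in J) P (X i @^-1` B i)%classic)%E.

(* The exponential law with mean 1 is the one with rate 1. *)
Definition exponential_clocks (n : nat) (T : pair_of n -> {RV P >-> R}) :=
  mutually_independent T /\
  forall (e : pair_of n) (A : set R), measurable A ->
    distribution P (T e) A = exponential_prob 1 A.

(* The graph at time [t], as an adjacency relation; it is irreflexive because
   [[set x; x]] has only one element. *)
Definition graph_process (n : nat) (T : pair_of n -> {RV P >-> R})
    (t : R) (w : Omega) : rel 'I_n :=
  fun x y => [exists e : pair_of n, (val e == [set x; y]%SET) && (T e w <= t)].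

Definition S_process (n : nat) (T : pair_of n -> {RV P >-> R})
    (k : nat) (t : R) (w : Omega) : R :=
  (comp_sum k (graph_process T t w))%:R.

End Process.

(* Main.v *)
Require Import Defs.
From HB Require Import structures.
From mathcomp Require Import all_boot all_order all_algebra.
From mathcomp Require Import zify ring lra.

Set Implicit Arguments.
Unset Strict Implicit.
Unset Printing Implicit Defensive.

Import Order.TTheory GRing.Theory Num.Theory.
Local Open Scope ring_scope.

(**
  Let c_m be the probability that G(m,p) is connected, q = 1 - p = e^{-t}, and
  nu_n(m) = C(n,m) c_m q^{m(n-m)} the expected number of components of size m.
  Removing a component leaves a random graph on the remaining vertices, so with
  f_k(n) = E S_k = sum_m m^k nu_n(m),
    E S_k S_l = f_{k+l}(n) + sum_m m^k nu_n(m) f_l(n-m),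
    Cov(S_k, S_l) = f_{k+l}(n) - sum_m m^k nu_n(m) (f_l(n) - f_l(n-m)).
  It remains to expand f_k(n)/n and the increments of f_l in x = 1/(1-nt).  No
  differential equation in t is needed: everything follows from the identities
  f_1(N) = N for all N, used through (n-m) nu_n(m) = n q^m nu_{n-1}(m).
  - With N = n + r and r of order n/x they bound an exponential moment of the
    size-biased component size at scale x^2, whence f_{k+1}(n) = O(n x^{2k-1}).
  - For L phi(n,m) = n phi(n,m) - (n-m) e^{tm} phi(n-1,m) they give
    E_n[L^k 1] = 1, where E_n is the size-biased mean.  Giving 1-nt, m and t the
    weights -1, 2 and -3, L^k 1 is, up to terms divisible by t of weight at most
    k, a polynomial in 1-nt and m with leading term ((1-nt) m)^k.  Solving this
    triangular system yields f_{k+1}(n)/n = B_k(x) + O(t x^{2k+2}) with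
    B_{j+1} = x B_j + x^2 (x-1) B_j'.
  - L m^b itself gives f_l(n) - f_l(n-1) = B_l(x)/x + O(t x^{2l+1}).
  The quadratic recursion for q_k says that p_{j+1} = B_j.
*)

(** * Borel polynomials *)

Lemma sum_binS (R : comNzRingType) (a b : nat -> R) k :
  \sum_(l < k.+2) 'C(k.+1, l)%:R * (a l * b (k.+1 - l)%N) =
  \sum_(l < k.+1) 'C(k, l)%:R * (a l.+1 * b (k - l)%N + a l * b (k.+1 - l)%N).
Proof.
rewrite big_ord_recl /= bin0 subn0 mul1r.
under eq_bigr => l _ do rewrite /bump /= add1n binS natrD mulrDl subSS.
under [RHS]eq_bigr do rewrite mulrDr.
rewrite !big_split /= addrA [RHS]addrC; congr (_ + _).
rewrite big_ord_recr /= bin_small // mul0r addr0 [RHS]big_ord_recl /= bin0 subn0 mul1r.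
by congr (_ + _); apply: eq_bigr => l _; rewrite /bump /= add1n subSS.
Qed.

Lemma all_flatten_map (S T : Type) (f : S -> seq T) (a : pred T) (b : pred S) s :
  (forall u, b u -> all a (f u)) -> all b s -> all a (flatten (map f s)).
Proof.
move=> ab; elim: s => //= u s IH /andP[bu bs].
by rewrite all_cat ab //= IH.
Qed.

Section BorelPolynomials.
Variable R : numFieldType.
Implicit Types f g : {poly R}.

(* The moments of the Borel distribution with parameter [1 - 1/x]. *)
Fixpoint borel_poly (j : nat) : {poly R} :=
  if j is i.+1 then
    'X * borel_poly i + 'X^2 * ('X - 1) * (borel_poly i)^`()
  else 1.

Local Notation B := borel_poly.

Lemma borel_polyS j : B j.+1 = 'X * B j + 'X^2 * ('X - 1) * (B j)^`().
Proof. by []. Qed.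

Lemma borel_poly0 : B 0 = 1.
Proof. by []. Qed.

Arguments borel_poly : simpl never.

Lemma deriv_nat n : (n%:R : {poly R})^`() = 0.
Proof. by rewrite -polyC_natr derivC. Qed.

Lemma borel_poly1 : B 1 = 'X.
Proof. by rewrite borel_polyS borel_poly0 derivC mulr0 addr0 mulr1. Qed.

(** The map taking B_j to B_{j+1} is multiplication by x plus the derivation f -> x^2 (x-1) f'. By
    Pascal's rule the convolution of order k+2 therefore arises from that of order k+1 by this
    derivation plus multiplication by 2x, and the right-hand side obeys the same recursion. *)
Lemma borel_convolution k :
  \sum_(l < k.+2) 'C(k.+1, l)%:R * (B l * B (k.+1 - l)%N) =
  B k.+1 *+ 2 + ('X^2 * (B k)^`()) *+ 2.
Proof.
elim: k => [|k IH].
  rewrite big_ord_recl big_ord1 bin0 (_ : lift _ _ = 1%N :> nat) // binn subn0 subnn /= derivC; ring.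
have rec : \sum_(l < k.+3) 'C(k.+2, l)%:R * (B l * B (k.+2 - l)%N) =
   'X *+ 2 * (\sum_(l < k.+2) 'C(k.+1, l)%:R * (B l * B (k.+1 - l)%N)) +
   'X^2 * ('X - 1) * (\sum_(l < k.+2) 'C(k.+1, l)%:R * (B l * B (k.+1 - l)%N))^`().
  rewrite sum_binS (raddf_sum (@deriv R)) !mulr_sumr -big_split; apply: eq_bigr => l _ /=.
  have le_lk : (l <= k.+1)%N by rewrite -ltnS.
  rewrite (subSn le_lk) !borel_polyS !derivM deriv_nat.
  move: (B l) (B (k.+1 - l)) (B l)^`() (B (k.+1 - l))^`() 'X%R (_%:R) => u v u' v' x c.
  by ring.
rewrite rec IH derivD !derivMn derivM derivXn (borel_polyS k.+1).
have E : (B k.+1)^`() = B k + 'X * (B k)^`() + ('X *+ 2 * ('X - 1) + 'X^2) * (B k)^`()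
    + 'X^2 * ('X - 1) * (B k)^`()^`().
  rewrite borel_polyS derivD !derivM !derivX derivB derivX derivC.
  move: (B k) (B k)^`() (B k)^`()^`() 'X%R => u v w x; ring.
rewrite E borel_polyS.
move: (B k) (B k)^`() (B k)^`()^`() 'X%R => u v w x; rewrite ?expr1; ring.
Qed.

Lemma deriv_borel k :
  'X^2 * (B k)^`() *+ 2 =
  \sum_(1 <= l < k.+1) 'C(k.+1, l)%:R * (B l * B (k.+1 - l)%N).
Proof.
have := borel_convolution k; rewrite -(big_mkord xpredT
  (fun l => 'C(k.+1, l)%:R * (B l * B (k.+1 - l)%N))).
rewrite big_nat_recr //= big_nat_recl // bin0 binn subn0 subnn big_add1 /= => E.
apply: (addrI (B k.+1 *+ 2)); rewrite -E borel_poly0; ring.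
Qed.

(* [borel_poly i.+2] divided by ['X^(i + 3)], see [borel_polyE]. *)
Fixpoint borel_q (i : nat) : {poly R} :=
  if i is j.+1 then
    ((j + 3)%:R * ('X - 1) + 1) * borel_q j + ('X^2 - 'X) * (borel_q j)^`()
  else 1.

Lemma borel_polyE i : B i.+2 = 'X^(i + 3) * borel_q i.
Proof.
elim: i => [|i IH].
  by rewrite borel_polyS borel_poly1 derivX /=; ring.
rewrite borel_polyS IH derivM derivXn /= addSn -addnS.
rewrite -mulr_natl (_ : 'X^(i + 4) = 'X^(i + 2) * 'X^2); last by rewrite -exprD -addnA.
rewrite (_ : 'X^(i + 3) = 'X^(i + 2) * 'X); last by rewrite -exprSr addnS.
rewrite addn3 addn2 /=; set w := 'X^(i.+2); move: (_%:R) (borel_q i) (borel_q i)^`() w 'X%R.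
by move=> a u v w x; ring.
Qed.

Lemma borel_q_horner1 i : (borel_q i).[1] = 1.
Proof.
elim: i => [|i IH] /=; first by rewrite hornerC.
by rewrite !hornerE /= IH; ring.
Qed.

Lemma deriv_inj f g : f^`() = g^`() -> f.[1] = g.[1] -> f = g.
Proof.
move=> dfg fg1.
have H i : (f - g)`_i.+1 = 0.
  have : (f - g)^`()`_i = 0 by rewrite derivB dfg subrr coef0.
  by rewrite coef_deriv => /eqP; rewrite mulrn_eq0 /= => /eqP.
have E : f - g = ((f - g)`_0)%:P.
  by apply/polyP => -[|i]; rewrite coefC //= H.
apply/eqP; rewrite -subr_eq0 E polyC_eq0.
by have := congr1 (horner^~ 1) E; rewrite hornerC hornerD hornerN fg1 subrr => <-.
Qed.

(** In [deriv_borel] the two extreme terms contain B_1 = x and cancel the part of (x^{i+3} q)' that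
    differentiates the power of x. After division by x^{i+5} the defining recursion of q_k
    remains. *)
Lemma borel_q_poly i : borel_q i = q_poly R (i + 3).
Proof.
elim/ltn_ind: i => i IH.
apply: deriv_inj; last by rewrite borel_q_horner1 q_horner1.
rewrite deriv_q ?leq_addl //.
have := deriv_borel i.+2.
rewrite big_ltn // big_nat_recr //= bin1 (_ : 'C(i.+3, i.+2) = i.+3); last first.
  by rewrite -bin_sub // subSnn bin1.
rewrite subSS subn0 subSnn borel_poly1 -/(B i.+2).
have -> : \sum_(2 <= l < i.+2) 'C(i.+3, l)%:R * (B l * B (i.+3 - l)) =
    'X^(i + 5) * \sum_(2 <= l < (i + 3).-1)
      'C(i + 3, l)%:R *: (q_poly R l.+1 * q_poly R (i + 3 - l).+1).
  rewrite mulr_sumr addn3 /=; apply: eq_big_nat => l /andP[l2 li].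
  have [a aE] : exists a, l = a.+2 by exists (l - 2)%N; lia.
  have [b bE] : exists b, (i.+3 - l)%N = b.+2 by exists (i.+1 - l)%N; lia.
  rewrite bE aE !borel_polyE (IH a) ?(IH b); [|lia|lia].
  have -> : 'X^(i + 5) = 'X^(a + 3) * 'X^(b + 3) :> {poly R}.
    by rewrite -exprD; congr (_ ^+ _); lia.
  rewrite -mul_polyC polyC_natr !addn3; set u := 'X^(a.+3); set v := 'X^(b.+3).
  by move: u v ('C(_, _)%:R) (q_poly R a.+3) (q_poly R b.+3) => u v w f g; ring.
rewrite borel_polyE derivM derivXn.
set S := (X in 'X^(i + 5) * X) => E.
have X0 : ('X^(i + 5) : {poly R}) != 0 by rewrite expf_neq0 // polyX_eq0.
apply: (mulfI X0); apply: (scalerI (a := 2%:R)); first by rewrite pnatr_eq0.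
rewrite -!scalerAr scalerA mulfV ?pnatr_eq0 // scale1r !scaler_nat.
rewrite -scaler_nat (_ : 'X^(i + 5) = 'X^(i + 2) * 'X * 'X^2) in E *; last first.
  by rewrite -exprSr -exprD; congr (_ ^+ _); lia.
rewrite -/S scaler_nat; move: E.
rewrite (_ : 'X^(i + 3) = 'X^(i + 2) * 'X); last by rewrite -exprSr addnS.
rewrite addn3 /= addn2 -(mulr_natl 'X^(i.+2)); set w := 'X^(i.+2).
move: (i.+3%:R) (borel_q i) (borel_q i)^`() w 'X%R S => a u v w x s.
move=> /eqP; rewrite -subr_eq0 => /eqP E; apply/eqP; rewrite -subr_eq0; apply/eqP.
by rewrite -[RHS]E; ring.
Qed.

Lemma p_poly_borel k : (2 <= k)%N -> p_poly R k = B k.-1.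
Proof.
case: k => [|[|[|i]]] // _; first by rewrite /p_poly /= borel_poly1.
by rewrite /p_poly /= borel_polyE borel_q_poly addn3.
Qed.

(** The double factorial (2j-1)!!, leading coefficient of B_{j+1}. *)
Definition odd_fact (j : nat) : nat := \prod_(i < j) i.*2.+1.

Lemma coef_borelS j i :
  (B j.+1)`_i.+3 = (B j)`_i.+2 + (B j)`_i.+1 *+ i.+1 - (B j)`_i.+2 *+ i.+2.
Proof.
rewrite borel_polyS mulrBr mulr1 -exprSr mulrBl coefD coefXM coefB !coefXnM /=.
by rewrite !subSS !subn0 !coef_deriv addrA.
Qed.

Lemma coef_borel_gt j i : (j.*2.+1 < i)%N -> (B j.+1)`_i = 0.
Proof.
elim: j i => [|j IH] i lt_ji; first by rewrite borel_poly1 coefX gtn_eqF.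
have [m mE] : exists m, i = m.+3 by exists (i - 3)%N; lia.
by rewrite mE coef_borelS !IH ?(mul0rn, subr0) ?addr0 //; lia.
Qed.

Lemma coef_borel_top j : (B j.+1)`_(j.*2.+1) = (odd_fact j)%:R.
Proof.
elim: j => [|j IH]; first by rewrite borel_poly1 coefX /odd_fact big_ord0.
rewrite doubleS coef_borelS IH coef_borel_gt ?mul0rn; last by [].
by rewrite add0r subr0 /odd_fact big_ord_recr /= natrM mulr_natr.
Qed.

(** Strictness prevents the leading terms of the two parts of [cov_poly] from cancelling. *)
Lemma odd_fact_lt a b : (0 < a)%N -> (0 < b)%N ->
  (odd_fact a * odd_fact b < odd_fact (a + b))%N.
Proof.
have pos c : (0 < odd_fact c)%N by apply: prodn_gt0.
move=> a0; case: b => // b _; elim: b => [|b IH].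
  rewrite addn1 /odd_fact [in X in (_ < X)%N]big_ord_recr big_ord1 ltn_pmul2l ?pos //.
  by rewrite /=; lia.
rewrite addnS /odd_fact [in X in (X < _)%N]big_ord_recr [in X in (_ < X)%N]big_ord_recr /=.
by rewrite mulnA; apply: ltn_mul => //; lia.
Qed.

(** The quotient p_{k+1} p_{l+1} / x is written out as x^{k+l+1} q_{k+1} q_{l+1}, a polynomial by
    construction. *)
Definition cov_poly k l : {poly R} :=
  B (k + l).-1 - 'X^((k + l).+1) * (q_poly R k.+1 * q_poly R l.+1).

Lemma mulX_cov_poly k l : (2 <= k)%N -> (2 <= l)%N ->
  'X * cov_poly k l = 'X * B (k + l).-1 - B k * B l.
Proof.
case: k => [|[|k]] // _; case: l => [|[|l]] // _.
rewrite /cov_poly mulrBr; congr (_ - _); rewrite !borel_polyE !borel_q_poly !addn3.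
rewrite [RHS]mulrACA -exprD [LHS]mulrA -exprS; congr (_ * _); congr (_ ^+ _); lia.
Qed.

Lemma size_cov_poly k l : (2 <= k)%N -> (2 <= l)%N ->
  size (cov_poly k l) = (2 * k + 2 * l - 3).+1%N.
Proof.
case: k => [|k] // k1; case: l => [|l] // l1.
have of0 j : ((odd_fact j)%:R : R) != 0 by rewrite pnatr_eq0 -lt0n; apply: prodn_gt0.
have sB j : size (B j.+1) = j.*2.+2.
  apply/eqP; rewrite eqn_leq; apply/andP; split.
    by apply/leq_sizeP => i ij; apply: coef_borel_gt.
  by rewrite ltnNge; apply: contra (of0 j) => sj; rewrite -coef_borel_top nth_default.
have B0 j : B j.+1 != 0 by rewrite -size_poly_gt0 sB.
have lB j : lead_coef (B j.+1) = (odd_fact j)%:R.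
  by rewrite lead_coefE sB -coef_borel_top.
have coefW i : (cov_poly k.+1 l.+1)`_i =
    (B (k + l).+1)`_i - (B k.+1 * B l.+1)`_i.+1.
  have := coefXM (cov_poly k.+1 l.+1) i.+1.
  by rewrite mulX_cov_poly // coefB coefXM !eqn0Ngt !ltn0Sn addnS /= => <-.
have sM : size (B k.+1 * B l.+1) = (k + l).*2.+3 by rewrite size_mul // !sB; lia.
have -> : (2 * k.+1 + 2 * l.+1 - 3 = (k + l).*2.+1)%N by lia.
apply/eqP; rewrite eqn_leq; apply/andP; split.
  by apply/leq_sizeP => i ij; rewrite coefW !nth_default ?subrr // ?sB ?sM; lia.
rewrite ltnNge; apply/negP => sW; have := coefW (k + l).*2.+1.
rewrite nth_default // coef_borel_top.
have -> : (B k.+1 * B l.+1)`_((k + l).*2.+2) = lead_coef (B k.+1 * B l.+1).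
  by rewrite lead_coefE sM.
rewrite lead_coefM !lB -natrM => /eqP; rewrite eq_sym subr_eq0 eqr_nat.
by rewrite gtn_eqF // odd_fact_lt.
Qed.

Lemma horner_cov_poly k l x : (2 <= k)%N -> (2 <= l)%N -> x != 0 ->
  (cov_poly k l).[x] = (B (k + l).-1).[x] - (B k).[x] * (B l).[x] / x.
Proof.
move=> k2 l2 x0; have := congr1 (horner^~ x) (mulX_cov_poly k2 l2).
by rewrite /= !hornerE => E; apply: (mulfI x0); rewrite E; field.
Qed.

(* A triple [(c, i, j)] stands for the monomial [c y^i m^j], where [y = 1 - n t];
   [ostep] is the leading part [y m f - (1 - y) df/dy] of [transport] below. *)
Definition ostep (u : R * nat * nat) : seq (R * nat * nat) :=
  let: (c, i, j) := u in
  [:: (c, i.+1, j.+1); (- (c *+ i), i.-1, j); (c *+ i, i, j)].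

Fixpoint omono (k : nat) : seq (R * nat * nat) :=
  if k is m.+1 then flatten (map ostep (omono m)) else [:: (1, 0%N, 0%N)].

(** The second inequality says that y^i m^j has weight 2j - i at most k; the first keeps k - i free
    of truncation in [omono_pairing]. *)
Lemma omono_bound k : all (fun u => (u.1.2 <= k)%N && (u.2.*2 <= k + u.1.2)%N) (omono k).
Proof.
elim: k => [|k IH] //=; apply: all_flatten_map IH.
by case=> [[c [|i]] j] /= H; lia.
Qed.

(** The top power of m occurs once, with coefficient y^k, which makes the system for the moments
    triangular. *)
Lemma omono_head k : exists s, omono k = (1, k, k) :: s /\ all (fun u => u.2 < k)%N s.
Proof.
elim: k => [|k [s [E sk]]]; first by exists [::].
rewrite /= E /=; eexists; split; first by [].
rewrite /= !ltnSn /=; apply: all_flatten_map sk.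
by case=> [[c i] j] /= H; lia.
Qed.

Lemma mulX_derivXn k : 'X * ('X^k)^`() = k%:R * 'X^k :> {poly R}.
Proof. by rewrite mulr_natl derivXn mulrnAr; case: k => [|k]; rewrite ?mulr0n // -exprS. Qed.

(* Multiplied by [y^k] at [x = 1 / y]: the mean of [omono k] is 1 when [m] has
   the moments [B]. *)
Lemma omono_pairing k :
  \sum_(u <- omono k) u.1.1 *: ('X^(k - u.1.2) * B u.2) = 'X^k.
Proof.
elim: k => [|k IH]; first by rewrite big_seq1 /= scale1r mulr1.
(* [F] is [ostep] seen through the pairing: it sends x^{k-i} B_j to the paired sum of the images of
   y^i m^j, and x^k to x^{k+1}. *)
pose F (f : {poly R}) := 'X * f + 'X^2 * ('X - 1) * f^`() - k%:R * (('X^2 - 'X) * f).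
transitivity (F (\sum_(u <- omono k) u.1.1 *: ('X^(k - u.1.2) * B u.2))); last first.
  rewrite IH /F (exprS 'X k); have := mulX_derivXn k.
  by move: 'X%R (k%:R) ('X^k) ('X^k)^`() => x a v d E; ring: E.
have FD : {morph F : f g / f + g} by move=> f g; rewrite /F derivD; move: (k%:R) => a; ring.
have F0 : F 0 = 0 by rewrite /F deriv0; ring.
rewrite (big_morph F FD F0) big_flatten big_map /=.
rewrite big_seq [RHS]big_seq; apply: eq_bigr => -[[c i] j] /(allP (omono_bound k)) /= /andP[ik _].
rewrite !big_cons big_nil /= subSS addr0 (subSn ik) scaleNr.
have e f : (c *+ i) *: f = c%:P * (i%:R * f).
  by rewrite mul_polyC mulr_natl -scalerMnl -scalerMnr.
have [m mE] : exists m, k = (i + m)%N by exists (k - i)%N; rewrite subnKC.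
(* At i = 0 the truncated [i.-1] is harmless because of the factor i. *)
have e' : i%:R * ('X^(k.+1 - i.-1) * B j) = i%:R * ('X * ('X * 'X^(k - i)) * B j).
  case: (i) mE => [|i'] mE; first by rewrite !mul0r.
  by congr (_ * (_ * _)); rewrite -!exprS; congr (_ ^+ _); lia.
rewrite !e e' /F derivZ derivM borel_polyS -!mul_polyC mE addKn (exprS 'X m).
have := mulX_derivXn m; rewrite natrD.
move: 'X%R (c%:P) (i%:R) (m%:R) ('X^m) ('X^m)^`() (B j) (B j)^`().
move=> x a i' m' v d b b' E; ring: E.
Qed.

End BorelPolynomials.

(** * Random graphs and their components *)

Section Bernoulli.
Variables (R : comRingType) (E : finType) (q : R).
Implicit Types (F g : {set E}) (f h : {set E} -> R).

Definition bern_wt g : R := \prod_(e : E) (if e \in g then 1 - q else q).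
Definition bern_E f : R := \sum_(g : {set E}) bern_wt g * f g.

Lemma prodD_subset (u v : E -> R) :
  \prod_e (u e + v e) = \sum_(g : {set E}) \prod_e (if e \in g then u e else v e).
Proof. exact: bigA_distr. Qed.

Lemma bern_E_cst (a : R) : bern_E (fun=> a) = a.
Proof.
rewrite /bern_E -mulr_suml /bern_wt -prodD_subset.
by rewrite big1 ?mul1r // => e _; rewrite subrK.
Qed.

Lemma bern_E_sum (I : finType) (Q : pred I) (f : I -> {set E} -> R) :
  bern_E (fun g => \sum_(i | Q i) f i g) = \sum_(i | Q i) bern_E (f i).
Proof.
by rewrite /bern_E exchange_big /=; apply: eq_bigr => g _; rewrite mulr_sumr.
Qed.

Lemma bern_EZ a f : bern_E (fun g => a * f g) = a * bern_E f.
Proof. by rewrite /bern_E mulr_sumr; apply: eq_bigr => g _; rewrite mulrCA. Qed.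

Lemma bern_E_D f h : bern_E (fun g => f g + h g) = bern_E f + bern_E h.
Proof. by rewrite /bern_E -big_split; apply: eq_bigr => g _; rewrite mulrDr. Qed.

Lemma eq_bern_E f h : f =1 h -> bern_E f = bern_E h.
Proof. by move=> fh; apply: eq_bigr => g _; rewrite fh. Qed.

Lemma bern_E_indep F f h :
  (forall g, f (g :&: F) = f g) -> (forall g, h (g :\: F) = h g) ->
  bern_E (fun g => f g * h g) = bern_E f * bern_E h.
Proof.
pose wt (B g : {set E}) : R := \prod_(e in B) (if e \in g then 1 - q else q).
pose A (B : {set E}) f : R := \sum_(g : {set E} | g \subset B) wt B g * f g.
have key f1 h1 : (forall g, f1 (g :&: F) = f1 g) ->
    (forall g, h1 (g :\: F) = h1 g) ->
    bern_E (fun g => f1 g * h1 g) = A F f1 * A (~: F) h1.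
  move=> f1F h1F; rewrite /A big_distrlr /= pair_big_dep /= /bern_E.
  rewrite (reindex_onto (fun u : {set E} * {set E} => u.1 :|: u.2)
             (fun g => (g :&: F, g :\: F))) /=; last by move=> g _; rewrite setID.
  apply: eq_big => [[a b]|[a b] /= /eqP[aE bE]] /=.
    rewrite xpair_eqE setIUl setDUl; apply/andP/andP => [[/eqP aE /eqP bE]|].
      by split; [rewrite -aE | rewrite -bE !setDE]; rewrite subUset !subsetIr.
    case=> aF bF; rewrite (setIidPl aF) (_ : b :&: F = set0) ?setU0 ?eqxx; last first.
      by apply/eqP; rewrite setI_eq0 disjoints_subset.
    rewrite (_ : a :\: F = set0) ?set0U; last by apply/eqP; rewrite setD_eq0.
    by rewrite setDE (setIidPl bF) eqxx.
  rewrite -(f1F (a :|: b)) -(h1F (a :|: b)) aE bE mulrACA; congr (_ * _).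
  rewrite /bern_wt (bigID (mem F)) /=; congr (_ * _).
    apply: eq_bigr => e eF; rewrite -[in RHS]aE !inE eF andbT.
    by [].
  rewrite /wt; apply: eq_big => e; first by rewrite inE.
  by move=> eF; rewrite -[in RHS]bE !inE eF.
move=> fF hF; have c1 : {set E} -> 1 = 1 :> R by [].
(* The partial sums [A] are not normalised separately; taking both functions equal to 1 shows that
   the masses over [F] and over its complement multiply to 1. *)
have E1 := key (fun=> 1) (fun=> 1) c1 c1.
have Ef := key f (fun=> 1) fF c1.
have Eh := key (fun=> 1) h c1 hF.
have f1 : bern_E (fun g => f g * 1) = bern_E f by apply: eq_bern_E => g; rewrite mulr1.
have h1 : bern_E (fun g => 1 * h g) = bern_E h by apply: eq_bern_E => g; rewrite mul1r.
rewrite f1 in Ef; rewrite h1 in Eh; rewrite bern_E_cst mul1r in E1.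
rewrite (key f h fF hF) Ef Eh.
move: (A F (fun=> 1)) (A (~: F) (fun=> 1)) E1 => a b E1.
by rewrite mulrACA -[LHS]mulr1 E1; ring.
Qed.

Lemma bern_E_avoid F : bern_E (fun g => (g :&: F == set0)%:R) = q ^+ #|F|.
Proof.
rewrite -prodr_const big_mkcond /=.
transitivity (\prod_(e : E) ((if e \in F then 0 else 1 - q) + q)); last first.
  by apply: eq_bigr => e _; case: ifP; rewrite ?add0r ?subrK.
rewrite prodD_subset; apply: eq_bigr => g _; rewrite /bern_wt.
have [gF|/set0Pn[e /setIP[eg eF]]] := eqVneq.
  rewrite mulr1; apply: eq_bigr => e _; case: ifP => // eg.
  case: ifP => // eF; have : e \in g :&: F by rewrite inE eg.
  by rewrite gF inE.
by rewrite mulr0 (bigD1 e) //= eg eF mul0r.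
Qed.

End Bernoulli.

Lemma connect_inv (V : finType) (e : rel V) (a : pred V) (x y : V) :
  (forall u v, a u -> e u v -> a v) -> a x -> connect e x y -> a y.
Proof.
move=> aP + /connectP[p + ->]; elim: p x => //= z p IHp x ax /andP[xz zp].
exact: IHp (aP _ _ ax xz) zp.
Qed.

(** * Components of induced subgraphs *)

Section Graph.
Variable n : nat.
Implicit Types (g : {set pair_of n}) (A B U : {set 'I_n}) (x y v : 'I_n).

Definition adj g : rel 'I_n :=
  fun x y => [exists e : pair_of n, (val e == [set x; y]) && (e \in g)].

Definition radj g U : rel 'I_n := [rel x y | [&& x \in U, y \in U & adj g x y]].

Definition induced_connected g A := [forall x in A, forall y in A, connect (radj g A) x y].

Definition inside A : {set pair_of n} := [set e : pair_of n | val e \subset A].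

Definition cut A B : {set pair_of n} :=
  [set e : pair_of n | [exists x in A, exists y in B, val e == [set x; y]]].

(* [A] is a component of the subgraph of [g] induced by [U]. *)
Definition is_comp g U A :=
  [&& A != set0, A \subset U, induced_connected g A & g :&: cut A (U :\: A) == set0].

Definition comp_of g U v := [set x | connect (radj g U) v x].

Lemma adj_sym g : symmetric (adj g).
Proof. by move=> x y; apply: eq_existsb => e; rewrite setUC. Qed.

Lemma radj_connect_sym g U : connect_sym (radj g U).
Proof.
by apply: sym_connect_sym => x y; rewrite /radj /= adj_sym andbCA.
Qed.

Lemma cutP g A B :
  reflect (forall x y, x \in A -> y \in B -> ~~ adj g x y) (g :&: cut A B == set0).
Proof.
apply: (iffP eqP) => [gAB x y xA yB|gAB].
  apply/existsP => -[e /andP[exy eg]].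
  suff : e \in g :&: cut A B by rewrite gAB inE.
  rewrite !inE eg /=; apply/existsP; exists x; rewrite xA /=.
  by apply/existsP; exists y; rewrite yB.
apply/setP => e; rewrite !inE; apply/negP => /andP[eg].
case/existsP => x /andP[xA] /existsP[y /andP[yB exy]].
by case/existsP: (gAB x y xA yB); exists e; rewrite exy.
Qed.

Lemma comp_of_sub g U v : v \in U -> comp_of g U v \subset U.
Proof.
move=> vU; apply/subsetP => x; rewrite inE.
by apply: (connect_inv (a := mem U)) => // u w _ /and3P[].
Qed.

Lemma connect_comp_of g U v x :
  connect (radj g U) v x -> connect (radj g (comp_of g U v)) v x.
Proof.
move=> vx; suff /andP[] : connect (radj g U) v x &&
  connect (radj g (comp_of g U v)) v x by [].
move: vx; apply: (connect_inv (a := fun z => connect (radj g U) v z &&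
    connect (radj g (comp_of g U v)) v z)); last by rewrite !connect0.
move=> u w /andP[vu vu'] uw.
have vw : connect (radj g U) v w by apply: connect_trans vu (connect1 uw).
rewrite vw /=; apply: connect_trans vu' (connect1 _).
by rewrite /radj /= !inE vu vw; case/and3P: uw.
Qed.

(** A connected set containing v lies in the component of v; with no edge leaving it inside [U], it
    is the whole component. Hence each vertex of [U] lies in exactly one component. *)
Lemma is_compE g U v A : v \in U ->
  is_comp g U A && (v \in A) = (A == comp_of g U v).
Proof.
move=> vU; apply/andP/eqP => [[/and4P[_ AU /forall_inP cA /cutP gA] vA]|->].
  apply/setP => x; rewrite inE; apply/idP/idP => [xA|].
    move/forall_inP: (cA v vA) => /(_ x xA); apply: connect_sub => u w.
    case/and3P=> uA wA uw; apply: connect1.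
    by rewrite /radj /= uw !(subsetP AU).
  apply: (connect_inv (a := mem A)) => // u w uA /and3P[_ wU uw].
  apply: contraT => wA; have := gA u w uA.
  by rewrite in_setD wU wA uw => /(_ isT).
have vC : v \in comp_of g U v by rewrite inE connect0.
split=> //; apply/and4P; split.
- by apply/set0Pn; exists v.
- exact: comp_of_sub.
- apply/forall_inP => x; rewrite inE => /connect_comp_of vx.
  apply/forall_inP => y; rewrite inE => /connect_comp_of vy.
  by apply: connect_trans vy; rewrite radj_connect_sym.
- apply/cutP => x y; rewrite !inE => vx /andP[vy yU]; apply: contra vy => xy.
  apply: connect_trans (vx) (connect1 _); rewrite /radj /= xy yU !andbT.
  by apply: (subsetP (comp_of_sub g vU)); rewrite inE.
Qed.

Lemma sum_comp_card (R : comRingType) g U :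
  \sum_(A : {set 'I_n}) #|A|%:R * (is_comp g U A)%:R = #|U|%:R :> R.
Proof.
transitivity (\sum_(A : {set 'I_n}) \sum_(v in U) (is_comp g U A && (v \in A))%:R : R).
  apply: eq_bigr => A _; case: (boolP (is_comp g U A)) => /= [cA|_]; last first.
    by rewrite mulr0 big1.
  case/and4P: cA => _ AU _ _.
  rewrite mulr1 -natr_sum; congr (_%:R); rewrite -big_mkcondr sum1dep_card.
  by apply: eq_card => v; rewrite !inE andb_idl //; apply: (subsetP AU).
rewrite exchange_big /=.
transitivity (\sum_(v in U) 1 : R); last by rewrite sumr_const.
apply: eq_bigr => v vU; rewrite (bigD1 (comp_of g U v)) //= is_compE // eqxx.
by rewrite big1 ?addr0 // => A nA; rewrite is_compE // (negPf nA).
Qed.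

Lemma components_adjE g A : (A \in components (adj g)) = is_comp g setT A.
Proof.
have E : connect (adj g) =2 connect (radj g setT).
  by apply: eq_connect => x y; rewrite /radj /= !inE.
apply/imsetP/idP => [[x _ ->]|cA].
  suff /eqP -> : [set y in [set: 'I_n] | connect (adj g) x y] == comp_of g setT x.
    by have := is_compE g (comp_of g setT x) (in_setT x); rewrite eqxx => /andP[].
  by apply/eqP/setP => y; rewrite !inE E.
case/and4P: (cA) => /set0Pn[x xA] _ _ _; exists x; first by rewrite inE.
have := is_compE g A (in_setT x); rewrite cA xA => /esym/eqP ->.
by apply/setP => y; rewrite !inE E.
Qed.

(** No edge joins [A] to its complement, so the other components are those of the graph left after
    deleting [A]. *)
Lemma is_comp_pair g A B : A != B ->
  is_comp g setT A && is_comp g setT B = is_comp g setT A && is_comp g (~: A) B.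
Proof.
move=> nAB; apply: andb_id2l => cA; case/and4P: (cA) => _ _ _ /cutP gA.
apply/idP/idP => [cB|]; last first.
  case/and4P=> B0 BA cB /cutP gB; apply/and4P; split=> //.
  apply/cutP => x y xB; rewrite !inE andbT => yB.
  have [yA|yA] := boolP (y \in A); last by apply: gB => //; rewrite !inE yB.
  rewrite adj_sym; apply: gA => //; rewrite !inE andbT.
  by move/subsetP: BA => /(_ x xB); rewrite inE.
case/and4P: (cB) => B0 _ conB /cutP gB; apply/and4P; split=> //.
  apply/subsetP => x xB; rewrite inE; apply: contra nAB => xA.
  have := is_compE g A (in_setT x); rewrite cA xA => /esym/eqP ->.
  by have := is_compE g B (in_setT x); rewrite cB xB => /esym/eqP ->.
by apply/cutP => x y xB; rewrite !inE => /andP[yB _]; apply: gB => //; rewrite !inE yB.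
Qed.

Lemma is_comp_irrefl g A : is_comp g (~: A) A = false.
Proof.
by apply/negP => /and4P[/set0Pn[x xA] /subsetP/(_ _ xA)]; rewrite inE xA.
Qed.

Lemma adj_inside g U x y : x \in U -> y \in U ->
  adj (g :&: inside U) x y = adj g x y.
Proof.
move=> xU yU; apply: eq_existsb => e; rewrite !inE.
by case: eqP => //= ->; rewrite subUset !sub1set xU yU !andbT.
Qed.

Lemma radj_inside g U A : A \subset U -> radj (g :&: inside U) A =2 radj g A.
Proof.
move=> AU x y; rewrite /radj /=; apply: andb_id2l => xA; apply: andb_id2l => yA.
by rewrite adj_inside // (subsetP AU).
Qed.

Lemma induced_connected_inside g U A : A \subset U ->
  induced_connected (g :&: inside U) A = induced_connected g A.
Proof.
move=> AU; apply: eq_forallb => x; congr (_ ==> _); apply: eq_forallb => y.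
by congr (_ ==> _); rewrite (eq_connect (radj_inside g AU)).
Qed.

Lemma cut_sub A B : [disjoint A & B] -> cut A B \subset ~: inside A.
Proof.
move=> dAB; apply/subsetP => e; rewrite !inE => /existsP[x /andP[xA]].
case/existsP=> y /andP[yB /eqP ->]; rewrite subUset !sub1set xA /=.
by apply: contraL yB => yA; rewrite (disjointFr dAB).
Qed.

(** Together with [is_comp_outside]: whether [B] is a component of the graph on the complement of
    [A], and whether [A] is a component of the whole graph, are decided by disjoint sets of
    edges. *)
Lemma is_comp_inside g U A : is_comp (g :&: inside U) U A = is_comp g U A.
Proof.
rewrite /is_comp; congr (_ && _); apply: andb_id2l => AU.
rewrite induced_connected_inside //; congr (_ && _).
apply/cutP/cutP => H x y xA yU; have := H x y xA yU; rewrite adj_inside //.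
- exact: (subsetP AU). - by case/setDP: yU.
- exact: (subsetP AU). - by case/setDP: yU.
Qed.

Lemma is_comp_outside g A : is_comp (g :\: inside (~: A)) setT A = is_comp g setT A.
Proof.
rewrite /is_comp; congr (_ && (_ && _)).
have H x y : x \in A -> adj (g :\: inside (~: A)) x y = adj g x y.
  move=> xA; apply: eq_existsb => e; rewrite !inE.
  by case: eqP => //= ->; rewrite subUset !sub1set !inE xA.
congr (_ && _).
  rewrite /induced_connected; apply: eq_forallb => x; congr (_ ==> _).
  apply: eq_forallb => y; congr (_ ==> _); apply: eq_connect => u w.
  by rewrite /radj /=; apply: andb_id2l => uA; rewrite H.
by apply/cutP/cutP => K x y xA yU; have := K x y xA yU; rewrite H.
Qed.

Lemma card_cut A B : [disjoint A & B] -> #|cut A B| = (#|A| * #|B|)%N.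
Proof.
move=> dAB; rewrite -cardsX -(card_imset _ val_inj).
pose f (u : 'I_n * 'I_n) := [set u.1; u.2].
rewrite -(card_in_imset (f := f) (D := setX A B)); last first.
  move=> [x y] [x' y']; rewrite !inE /f /= => /andP[xA yB] /andP[xA' yB'] /setP E.
  have nxy u w : u \in A -> w \in B -> u != w.
    by move=> uA wB; apply: contraTneq wB => <-; rewrite (disjointFr dAB).
  have := E x; rewrite !inE eqxx /= (negPf (nxy _ _ xA yB')) orbF => /esym/eqP ->.
  have := E y; rewrite !inE eqxx orbT eq_sym (negPf (nxy _ _ xA' yB)) /=.
  by move=> /esym/eqP ->.
apply: eq_card => X; apply/imsetP/imsetP.
  case=> e; rewrite inE => /existsP[x /andP[xA]] /existsP[y /andP[yB /eqP exy]] ->.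
  by exists (x, y) => //; rewrite inE xA.
case=> -[x y]; rewrite !inE /f /= => /andP[xA yB] ->.
have xy : #|[set x; y]| == 2%N.
  rewrite cards2; suff -> : x != y by [].
  by apply: contraTneq yB => <-; rewrite (disjointFr dAB).
exists (exist _ [set x; y] xy : pair_of n) => //; rewrite inE.
by apply/existsP; exists x; rewrite xA; apply/existsP; exists y; rewrite yB /=.
Qed.

End Graph.

Lemma sum_subsets (R : nzRingType) (V : finType) (U : {set V}) (phi : nat -> R) :
  \sum_(A : {set V} | A \subset U) phi #|A| =
  \sum_(m < #|U|.+1) 'C(#|U|, m)%:R * phi m.
Proof.
rewrite (partition_big (fun A : {set V} => inord #|A| : 'I_#|U|.+1) xpredT) //=.
apply: eq_bigr => m _; have := cards_draws U m => <-.
rewrite -[X in X%:R * _]sum1_card natr_sum mulr_suml.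
rewrite big_mkcond [RHS]big_mkcond /=; apply: eq_bigr => A _; rewrite inE.
case: (boolP (A \subset U)) => //= AU.
have E : (inord #|A| == m) = (#|A| == m :> nat).
  by rewrite -val_eqE /= inordK // ltnS subset_leq_card.
by rewrite E; case: eqP => // ->; rewrite mul1r.
Qed.

(** * Expected component counts and mixed second moments *)

Section GraphMoments.
Variables (R : realFieldType) (q : R).

Definition conn_prob m : R :=
  bern_E q (fun g : {set pair_of m} => (induced_connected g [set: 'I_m])%:R).

(* The expected number of components of size [m] in G(n, 1 - q). *)
Definition comp_mean (n m : nat) : R :=
  'C(n, m)%:R * (conn_prob m * q ^+ (m * (n - m))).

Definition moment (k n : nat) : R := \sum_(m < n.+1) m%:R ^+ k * comp_mean n m.

Section Fixed_n.
Variable n : nat.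
Implicit Types (A B U : {set 'I_n}).
Local Notation E := (@bern_E R (pair_of n) q).

(** Connectivity of [A] depends on the edges inside [A], its isolation on those of the cut towards
    [U :\: A]; hence the product. *)
Lemma is_comp_prob U A : A != set0 -> A \subset U ->
  E (fun g => (is_comp g U A)%:R) =
  E (fun g => (induced_connected g A)%:R) * q ^+ (#|A| * (#|U| - #|A|)).
Proof.
move=> A0 AU.
have dA : [disjoint A & U :\: A].
  by rewrite -setI_eq0 setIDA setIC -setIDA setDv setI0.
rewrite -[#|U|](cardsID A) (setIidPr AU) addKn -card_cut // -bern_E_avoid.
rewrite -(@bern_E_indep _ _ q (inside A)).
- by apply: eq_bern_E => g; rewrite /is_comp A0 AU /= -mulnb natrM.
- by move=> g; rewrite induced_connected_inside.
- move=> g; rewrite setDE -setIA; congr (_ == _)%:R; congr (_ :&: _).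
  by apply/setIidPr; apply: cut_sub.
Qed.

(** The empty set is never a component but counts as connected; [w set0 = 0] removes its term. *)
Lemma sum_is_comp_prob U (w : {set 'I_n} -> R) : w set0 = 0 ->
  \sum_A w A * E (fun g => (is_comp g U A)%:R) =
  \sum_(A : {set 'I_n} | A \subset U)
    w A * (E (fun g => (induced_connected g A)%:R) * q ^+ (#|A| * (#|U| - #|A|))).
Proof.
move=> w0; rewrite [RHS]big_mkcond; apply: eq_bigr => A _.
have [->|A0] := eqVneq A set0; first by rewrite w0 !mul0r if_same.
case: ifPn => AU; first by rewrite is_comp_prob.
rewrite (eq_bern_E _ (h := fun=> 0)) ?bern_E_cst ?mulr0 // => g.
by rewrite /is_comp (negPf AU) andbF.
Qed.

Lemma sum_comp_prob U :
  \sum_(A : {set 'I_n} | A \subset U) #|A|%:R *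
    (E (fun g => (induced_connected g A)%:R) * q ^+ (#|A| * (#|U| - #|A|))) = #|U|%:R.
Proof.
rewrite -(sum_is_comp_prob U (w := fun A => #|A|%:R)) ?cards0 //.
rewrite -[RHS](bern_E_cst (pair_of n) q).
rewrite -(eq_bern_E _ (fun g => sum_comp_card R g U)).
by rewrite bern_E_sum; apply: eq_bigr => A _; rewrite bern_EZ.
Qed.

End Fixed_n.

(* Counting the vertices of [U] by components determines the probability that [U]
   is connected from those of its proper subsets, so that it depends on the
   size of [U] only. *)
Lemma sum_comp_mean_aux n (U : {set 'I_n}) :
  (forall A : {set 'I_n}, A != set0 -> A \proper U ->
    bern_E q (fun g => (induced_connected g A)%:R) = conn_prob #|A|) ->
  \sum_(m < #|U|.+1) m%:R * comp_mean #|U| m =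
  #|U|%:R + #|U|%:R * (conn_prob #|U| - bern_E q (fun g => (induced_connected g U)%:R)).
Proof.
move=> IH; rewrite -[X in X + _](sum_comp_prob U).
transitivity (\sum_(A : {set 'I_n} | A \subset U)
    #|A|%:R * (conn_prob #|A| * q ^+ (#|A| * (#|U| - #|A|)))).
  rewrite (sum_subsets _
    (fun m => m%:R * (conn_prob m * q ^+ (m * (#|U| - m))))).
  by apply: eq_bigr => m _; rewrite /comp_mean mulrCA.
rewrite [LHS](bigD1 U) //= [X in _ = X + _](bigD1 U) //=.
rewrite subnn muln0 expr0 !mulr1.
rewrite [X in _ + X = _](_ : _ = \sum_(A : {set 'I_n} | (A \subset U) && (A != U))
   #|A|%:R * (bern_E q (fun g => (induced_connected g A)%:R) * q ^+ (#|A| * (#|U| - #|A|)))).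
  by ring.
apply: eq_bigr => A /andP[AU nAU].
have [->|A0] := eqVneq A set0; first by rewrite cards0 !mul0r.
by rewrite IH // properEneq nAU.
Qed.

(** Strong induction on the size: by [sum_comp_mean_aux] one and the same sum determines the
    connection probability of [A] and that of the full set of m vertices. *)
Lemma induced_connectedE n (A : {set 'I_n}) : A != set0 ->
  bern_E q (fun g => (induced_connected g A)%:R) = conn_prob #|A|.
Proof.
move mE : #|A| => m; elim/ltn_ind: m n A mE => m IH n A mE A0.
have m0 : (m%:R : R) != 0 by rewrite -mE pnatr_eq0 cards_eq0.
have HA := @sum_comp_mean_aux n A; have := @sum_comp_mean_aux m [set: 'I_m].
rewrite mE in HA; rewrite cardsT card_ord HA => [H|B B0 BA]; last first.
  by apply: (IH #|B|) => //; rewrite -mE; apply: proper_card.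
suff /addrI/(mulfI m0)/addrI/oppr_inj -> : m%:R + m%:R * (conn_prob m -
    bern_E q (fun g => (induced_connected g A)%:R)) = m%:R + m%:R * (conn_prob m - conn_prob m).
  by [].
apply: H => B B0 BA; apply: (IH #|B|) => //.
by have := proper_card BA; rewrite cardsT card_ord.
Qed.

(** The later estimates use the connection probabilities only through this identity and their
    nonnegativity. *)
Lemma moment1 n : moment 1 n = n%:R.
Proof.
have := @sum_comp_mean_aux n [set: 'I_n]; rewrite cardsT card_ord => H.
rewrite /moment; under eq_bigr do rewrite expr1.
rewrite H ?subrr ?mulr0 ?addr0 //.
by move=> A A0 _; apply: induced_connectedE.
Qed.

Lemma sum_comp_mean n (U : {set 'I_n}) (w : nat -> R) : w 0%N = 0 ->
  \sum_(A : {set 'I_n}) w #|A| * bern_E q (fun g => (is_comp g U A)%:R) =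
  \sum_(m < #|U|.+1) w m * comp_mean #|U| m.
Proof.
move=> w0; rewrite (@sum_is_comp_prob n U (fun A => w #|A|)) ?cards0 //.
transitivity (\sum_(A : {set 'I_n} | A \subset U)
    w #|A| * (conn_prob #|A| * q ^+ (#|A| * (#|U| - #|A|)))).
  apply: eq_bigr => A AU; have [->|A0] := eqVneq A set0; last by rewrite induced_connectedE.
  by rewrite cards0 w0 !mul0r.
rewrite (sum_subsets _ (fun m => w m * (conn_prob m * q ^+ (m * (#|U| - m))))).
by apply: eq_bigr => m _; rewrite /comp_mean mulrCA.
Qed.

Lemma comp_sumE n k (g : {set pair_of n}) :
  (comp_sum k (adj g))%:R =
  \sum_(A : {set 'I_n}) #|A|%:R ^+ k * (is_comp g setT A)%:R :> R.
Proof.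
rewrite /comp_sum natr_sum big_mkcond; apply: eq_bigr => A _.
by rewrite components_adjE; case: is_comp; rewrite ?mulr1 ?mulr0 // natrX.
Qed.

Lemma bern_E_comp_sum n k : (0 < k)%N ->
  bern_E q (fun g : {set pair_of n} => (comp_sum k (adj g))%:R) = moment k n.
Proof.
move=> k0; rewrite (eq_bern_E _ (comp_sumE k)) bern_E_sum.
under eq_bigr do rewrite bern_EZ.
rewrite (@sum_comp_mean n _ (fun m => m%:R ^+ k)) ?cardsT ?card_ord //.
by rewrite expr0n eqn0Ngt k0.
Qed.

(** Pairs of equal components give the moment of order k + l. For distinct ones, given a component
    [A], the rest is a random graph on the n - |A| other vertices, independent of the event that [A]
    is a component. *)
Lemma bern_E_comp_sum2 n k l : (0 < k)%N -> (0 < l)%N ->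
  bern_E q (fun g : {set pair_of n} =>
    (comp_sum k (adj g))%:R * (comp_sum l (adj g))%:R) =
  moment (k + l) n + \sum_(m < n.+1) m%:R ^+ k * comp_mean n m * moment l (n - m).
Proof.
move=> k0 l0; pose I (g : {set pair_of n}) U A : R := (is_comp g U A)%:R.
have split2 g : (comp_sum k (adj g))%:R * (comp_sum l (adj g))%:R =
    \sum_(A : {set 'I_n}) #|A|%:R ^+ (k + l) * I g setT A +
    \sum_(A : {set 'I_n}) \sum_(B : {set 'I_n})
      #|A|%:R ^+ k * #|B|%:R ^+ l * (I g (~: A) B * I g setT A).
  rewrite !comp_sumE big_distrlr -big_split /=; apply: eq_bigr => A _.
  (* In the double sum over [B] the diagonal term vanishes by [is_comp_irrefl], so all [B] may be
     kept. *)
  rewrite (bigD1 A) //= [X in _ = _ + X](bigD1 A) //=.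
  rewrite [in X in _ = _ + (X + _)]/I is_comp_irrefl mul0r mulr0 add0r exprD.
  rewrite mulrACA -natrM mulnb andbb; congr (_ + _).
  apply: eq_bigr => B nBA; rewrite mulrACA; congr (_ * _).
  by rewrite -!natrM !mulnb is_comp_pair 1?eq_sym // andbC.
rewrite (eq_bern_E _ split2) bern_E_D !bern_E_sum; congr (_ + _).
  under eq_bigr do rewrite bern_EZ.
  rewrite (@sum_comp_mean n _ (fun m => m%:R ^+ (k + l))) ?cardsT ?card_ord //.
  by rewrite expr0n addn_eq0 eqn0Ngt k0.
have inner (A : {set 'I_n}) : bern_E q (fun g => \sum_(B : {set 'I_n})
      #|A|%:R ^+ k * #|B|%:R ^+ l * (I g (~: A) B * I g setT A)) =
    #|A|%:R ^+ k * moment l (n - #|A|) * bern_E q (fun g => I g setT A).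
  rewrite bern_E_sum; under eq_bigr do rewrite bern_EZ.
  under eq_bigr => B _ do [rewrite (@bern_E_indep _ _ q (inside (~: A)));
    [|by move=> g; rewrite /I is_comp_inside|by move=> g; rewrite /I is_comp_outside]].
  under eq_bigr do rewrite mulrA.
  rewrite -mulr_suml; congr (_ * _).
  under eq_bigr do rewrite -mulrA.
  rewrite -mulr_sumr; congr (_ * _).
  rewrite (@sum_comp_mean n _ (fun m => m%:R ^+ l)); last by rewrite expr0n eqn0Ngt l0.
  by rewrite cardsCs setCK card_ord.
under eq_bigr do rewrite inner.
rewrite (@sum_comp_mean n _ (fun m => m%:R ^+ k * moment l (n - m))) ?cardsT ?card_ord.
  by apply: eq_bigr => m _; rewrite mulrAC.
by rewrite expr0n eqn0Ngt k0 mul0r.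
Qed.

Hypothesis q01 : 0 <= q <= 1.

Lemma comp_mean_ge0 n m : 0 <= comp_mean n m.
Proof.
case/andP: q01 => q0 q1; rewrite !mulr_ge0 ?exprn_ge0 //.
apply: sumr_ge0 => g _; rewrite mulr_ge0 //; apply: prodr_ge0 => e _.
by case: ifP; rewrite ?subr_ge0.
Qed.

End GraphMoments.

(** * Moments of the component size *)

From mathcomp Require Import all_classical all_reals all_analysis.

(** * Bounds with a constant uniform in t and n *)

Section UnifBound.
Variables (R : realFieldType) (dom : R -> nat -> Prop).
Implicit Types f g b : R -> nat -> R.

Definition unif_bound f b :=
  exists2 C : R, 0 <= C & forall t n, dom t n -> `|f t n| <= C * b t n.

Lemma unif_bound_add f g b :
  unif_bound f b -> unif_bound g b -> unif_bound (fun t n => f t n + g t n) b.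
Proof.
move=> [C C0 fC] [C' C'0 gC']; exists (C + C'); first exact: addr_ge0.
move=> t n D; rewrite mulrDl; apply: le_trans (ler_normD _ _) _.
by apply: lerD; [apply: fC | apply: gC'].
Qed.

Lemma unif_bound_sum (T : eqType) (s : seq T) (f : T -> R -> nat -> R) b :
  (forall t n, dom t n -> 0 <= b t n) ->
  (forall u, u \in s -> unif_bound (f u) b) -> unif_bound (fun t n => \sum_(u <- s) f u t n) b.
Proof.
move=> b0; elim: s => [|u s IH] fb.
  by exists 0 => // t n D; rewrite big_nil normr0 mul0r.
have [C C0 IC] := IH (fun v vs => fb v (mem_behead (s := u :: s) vs)).
have [C' C'0 uC] := fb u (mem_head u s).
exists (C' + C); first exact: addr_ge0.
move=> t n D; rewrite big_cons mulrDl; apply: le_trans (ler_normD _ _) _.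
by apply: lerD; [apply: uC | apply: IC].
Qed.

End UnifBound.

(** * Size-biased sums and the operator L *)

Section SizeBias.
Variable R : realType.
Implicit Types (t : R) (n m : nat) (phi psi : nat -> R).

Definition subcritical t n := [/\ (0 < n)%N, 0 <= t & n%:R * t < 1].

Definition gap t n : R := 1 - n%:R * t.

(* [n] times the mean of [phi] at the size of the component of a given vertex. *)
Definition sb_sum t n phi : R :=
  \sum_(m < n.+1) m%:R * comp_mean (expR (- t)) n m * phi m.

Lemma expRN01 t : 0 <= t -> 0 <= expR (- t) <= 1.
Proof. by move=> t0; rewrite expR_ge0 -expR0 ler_expR oppr_le0. Qed.

Lemma sb_sum_le t n phi psi : 0 <= t ->
  (forall m, (0 < m <= n)%N -> phi m <= psi m) -> sb_sum t n phi <= sb_sum t n psi.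
Proof.
move=> t0 le_pp; apply: ler_sum => -[[|m] lt_mn] _; first by rewrite !mul0r.
apply: ler_wpM2l; last by apply: le_pp.
by rewrite mulr_ge0 // comp_mean_ge0 // expRN01.
Qed.

Lemma sb_sumD t n phi psi :
  sb_sum t n (fun m => phi m + psi m) = sb_sum t n phi + sb_sum t n psi.
Proof. by rewrite /sb_sum -big_split; apply: eq_bigr => m _; rewrite mulrDr. Qed.

Lemma sb_sumZ t n a phi : sb_sum t n (fun m => a * phi m) = a * sb_sum t n phi.
Proof. by rewrite /sb_sum mulr_sumr; apply: eq_bigr => m _; rewrite mulrCA. Qed.

Lemma sb_sum_norm t n phi : 0 <= t ->
  `|sb_sum t n phi| <= sb_sum t n (fun m => `|phi m|).
Proof.
move=> t0; rewrite ler_norml; apply/andP; split.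
  rewrite -mulN1r -sb_sumZ; apply: sb_sum_le => // m _.
  by rewrite mulN1r lerNl ler_normr lexx orbT.
by apply: sb_sum_le => // m _; rewrite ler_norm.
Qed.

Lemma sb_sum_moment t n k :
  sb_sum t n (fun m => m%:R ^+ k) = moment (expR (- t)) k.+1 n.
Proof. by apply: eq_bigr => m _; rewrite exprS mulrAC. Qed.

Lemma sb_sum1 t n : sb_sum t n (fun=> 1) = n%:R.
Proof. by rewrite -(moment1 (expR (- t)) n) -sb_sum_moment. Qed.

Lemma sb_sum_cst t n a : sb_sum t n (fun=> a) = a * n%:R.
Proof. by rewrite -(sb_sum1 t) -sb_sumZ; apply: eq_bigr => m _; rewrite mulr1. Qed.

(** One vertex fewer removes m edges from the cut, and (n+1-m) C(n+1,m) = (n+1) C(n,m). At m = n+1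
    both sides vanish. *)
Lemma comp_mean_shift q n m : (m <= n.+1)%N ->
  (n.+1%:R - m%:R) * comp_mean q n.+1 m = n.+1%:R * q ^+ m * comp_mean q n m :> R.
Proof.
rewrite leq_eqVlt => /orP[/eqP ->|].
  by rewrite subrr mul0r /comp_mean bin_small // mul0r mulr0.
rewrite ltnS => le_mn; rewrite /comp_mean -natrB; last exact: leqW.
have : (n.+1 - m)%:R * 'C(n.+1, m)%:R = n.+1%:R * 'C(n, m)%:R :> R.
  by rewrite -!natrM -mul_bin_down.
rewrite subSn // mulnS exprD.
move: (_.+1%:R) ('C(_, _)%:R) ('C(_, _)%:R) (n.+1%:R) => a b c d E; ring: E.
Qed.

(* The operator L, with [n] extended to a real [v] so that [v - 1] is not truncated. *)
Definition transport (f : R -> R -> nat -> R) t (v : R) m : R :=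
  v * f t v m - (v - m%:R) * expR (t * m%:R) * f t (v - 1) m.

(** The factor e^{tm} cancels the q^m of [comp_mean_shift], which turns the second term of
    [transport] into a sum for the graph with one vertex fewer. *)
Lemma sb_sum_transport f t n :
  sb_sum t n.+1 (transport f t n.+1%:R) =
  n.+1%:R * (sb_sum t n.+1 (f t n.+1%:R) - sb_sum t n (f t n%:R)).
Proof.
rewrite [X in _ - X](_ : _ = \sum_(m < n.+2)
    m%:R * comp_mean (expR (- t)) n m * f t n%:R m); last first.
  by rewrite big_ord_recr /= /comp_mean bin_small // !mul0r mulr0 mul0r addr0.
rewrite -sumrB mulr_sumr; apply: eq_bigr => m _.
have le_mn : (m <= n.+1)%N by rewrite -ltnS.
rewrite /transport (_ : n.+1%:R - 1 = n%:R); last by rewrite -natr1 addrK.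
have := comp_mean_shift (expR (- t)) le_mn.
have -> : expR (- t) ^+ m = (expR (t * m%:R))^-1.
  by rewrite -expRN -mulNr expRM_natr.
have := expR_gt0 (t * m%:R); move: (expR (t * m%:R)) => e e0 E.
rewrite !mulrBr; congr (_ - _); first by ring.
transitivity (m%:R * e * ((n.+1%:R - m%:R) * comp_mean (expR (- t)) n.+1 m) * f t n%:R m).
  by ring.
by rewrite E; field; rewrite gt_eqF.
Qed.

End SizeBias.

(** Each factor of the quotient of binomials satisfies (n+r-i)/(n-i) >= (n+r)/n. *)
Lemma bin_ratio n r m : (m <= n)%N ->
  ((n + r) ^ m * 'C(n, m) <= n ^ m * 'C(n + r, m))%N.
Proof.
elim: m => [|m IH] lt_mn; first by rewrite !bin0.
rewrite -(leq_pmul2l (ltn0Sn m)) !mulnA ![(m.+1 * _)%N]mulnC -!mulnA !mul_bin_left.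
have {}IH := IH (ltnW lt_mn).
apply: (@leq_trans ((n + r) ^ m * 'C(n, m) * (n * (n + r - m)))).
  rewrite expnS; have : ((n + r) * (n - m) <= n * (n + r - m))%N by nia.
  move: ((n + r) ^ m)%N ('C(n, m)) => a b; nia.
have := leq_mul IH (leqnn (n * (n + r - m))).
by rewrite expnS; move: (n ^ m)%N ('C(n + r, m)) ((n + r) ^ m)%N ('C(n, m)) (n + r - m)%N; lia.
Qed.

(** * Moment bounds from an exponential moment *)

Section MomentBounds.
Variable R : realType.
Implicit Types (t : R) (n m : nat).

Lemma expR_half_le (a : R) : 0 <= a <= 1 -> expR (a / 2) <= 1 + a.
Proof.
move=> /andP[a0 a1]; have := expR_ge1Dx (- (a / 2)); rewrite expRN.
have := expR_gt0 (a / 2); move: (expR _) => e e0 H.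
have : 1 - a / 2 <= e^-1 by [].
rewrite -(ler_pM2r e0) mulVf ?gt_eqF // => {}H.
rewrite -(@ler_pM2l _ (1 - a / 2)); last by lra.
by apply: le_trans H _; nra.
Qed.

(* Compares [comp_mean] on [n + r] and on [n] vertices. *)
Lemma sb_sum_tilt t n r : 0 <= t -> (0 < n)%N ->
  sb_sum t n (fun m => ((1 + r%:R / n%:R) * expR (- t) ^+ r) ^+ m) <= n%:R + r%:R.
Proof.
move=> t0 n0; have n0' : (n%:R : R) != 0 by rewrite pnatr_eq0 -lt0n.
rewrite -natrD -(sb_sum1 t (n + r)) /sb_sum.
rewrite -(big_mkord xpredT (fun m => m%:R * comp_mean (expR (- t)) n m *
    ((1 + r%:R / n%:R) * expR (- t) ^+ r) ^+ m)).
rewrite -[X in _ <= X](big_mkord xpredT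
   (fun m => m%:R * comp_mean (expR (- t)) (n + r) m * 1)).
(* The terms with n < m <= n + r are nonnegative and are dropped. *)
rewrite [X in _ <= X](@big_cat_nat _ _ _ n.+1) //=; last by rewrite ltnS leq_addr.
rewrite -[X in X <= _]addr0; apply: lerD; last first.
  by apply: sumr_ge0 => m _; rewrite mulr1 mulr_ge0 // comp_mean_ge0 // expRN01.
apply: ler_sum_nat => m /andP[_]; rewrite ltnS => le_mn.
rewrite mulr1 -mulrA ler_wpM2l // /comp_mean.
have c0 : 0 <= conn_prob (expR (- t)) m.
  have := comp_mean_ge0 (expRN01 t0) m m.
  by rewrite /comp_mean binn mul1r subnn muln0 expr0 mulr1.
have E : 'C(n, m)%:R * (1 + r%:R / n%:R) ^+ m <= 'C(n + r, m)%:R :> R.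
  have -> : 1 + r%:R / n%:R = (n + r)%:R / n%:R :> R by rewrite natrD mulrDl divff.
  rewrite expr_div_n mulrA ler_pdivrMr; last by rewrite exprn_gt0 // ltr0n.
  by rewrite -!natrX -!natrM ler_nat mulnC [X in (_ <= X)%N]mulnC bin_ratio.
have -> : expR (- t) ^+ (m * (n + r - m)) =
    expR (- t) ^+ (m * (n - m)) * (expR (- t) ^+ r) ^+ m.
  by rewrite -exprM -exprD; congr (_ ^+ _); nia.
rewrite exprMn; move: E; move: (conn_prob _ _) c0 => c c0.
have : 0 <= expR (- t) ^+ (m * (n - m)) * (expR (- t) ^+ r) ^+ m.
  by rewrite mulr_ge0 ?exprn_ge0 ?expR_ge0.
move: (_ ^+ (m * (n - m))) ((_ ^+ r) ^+ m) => a b ab E.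
rewrite [X in _ <= X]mulrA.
rewrite [X in X <= _](_ : _ = 'C(n, m)%:R * (1 + r%:R / n%:R) ^+ m * c * (a * b)); last by ring.
by do 2! apply: ler_wpM2r => //.
Qed.

Lemma gap_gt0 t n : subcritical t n -> 0 < gap t n.
Proof. by case=> _ _; rewrite /gap subr_gt0. Qed.

Lemma gap_le1 t n : subcritical t n -> gap t n <= 1.
Proof. by case=> _ t0 _; rewrite /gap gerBl mulr_ge0. Qed.

Lemma gap_inv_ge1 t n : subcritical t n -> 1 <= (gap t n)^-1.
Proof. by move=> D; rewrite invf_ge1 ?gap_le1 ?gap_gt0. Qed.

(** With u = r/n and y the gap, u <= y/2 gives (1+u) e^{-tr} >= (1+u)(1 - u n t) >= 1 + u y / 2 = 1
    + 2a >= e^a, so [sb_sum_tilt] controls an exponential moment at scale 1/a. *)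
Lemma sb_sum_exp_le t n r k (a := r%:R / n%:R * gap t n / 4) :
  subcritical t n -> r%:R / n%:R <= gap t n / 2 ->
  sb_sum t n (fun m => (a * m%:R) ^+ k.+1) <= k.+1`!%:R * r%:R.
Proof.
move=> D ru; have [n0 t0 nt] := D; have y0 := gap_gt0 D; have y1 := gap_le1 D.
have n0' : (n%:R : R) != 0 by rewrite pnatr_eq0 -lt0n.
have u0 : 0 <= (r%:R / n%:R : R) by rewrite divr_ge0.
have a0 : 0 <= a by rewrite /a !mulr_ge0 // ltW.
have f0 : 0 < (k.+1`!)%:R :> R by rewrite ltr0n fact_gt0.
rewrite -ler_pdivrMl // -sb_sumZ.
have tilt := sb_sum_tilt r t0 n0.
(* Subtracting 1 from the exponential lowers the bound from n + r to r, and r <= n y / 2. *)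
apply: (@le_trans _ _ (sb_sum t n (fun m =>
    -1 + ((1 + r%:R / n%:R) * expR (- t) ^+ r) ^+ m))); last first.
  by rewrite sb_sumD sb_sum_cst mulN1r addrC lerBlDl.
apply: sb_sum_le => // m /andP[m0 le_mn].
rewrite addrC lerBrDl.
have base : 1 + a *+ 2 <= (1 + r%:R / n%:R) * expR (- t) ^+ r.
  have : 1 - t * r%:R <= expR (- t) ^+ r.
    by rewrite -expRM_natr mulNr expR_ge1Dx.
  rewrite (_ : t * r%:R = r%:R / n%:R * (n%:R * t)); last by field.
  rewrite /a; move: (expR _ ^+ r) => e He; move: He ru u0 y1 y0.
  rewrite /gap; move: (r%:R / n%:R) (n%:R * t) nt => u w nt He ru u0 y1 y0.
  apply: (@le_trans _ _ ((1 + u) * (1 - u * w))); last by rewrite ler_wpM2l //; lra.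
  by rewrite -mulr_natl; nra.
have step : expR a <= (1 + r%:R / n%:R) * expR (- t) ^+ r.
  apply: le_trans base; rewrite [X in expR X](_ : a = a *+ 2 / 2); last by rewrite -mulr_natl; field.
  apply: expR_half_le; rewrite mulrn_wge0 //=; rewrite /a -mulr_natl.
  by move: ru u0 y1 y0; move: (r%:R / n%:R) (gap t n) => u y; nra.
apply: (@le_trans _ _ (expR a ^+ m)); last first.
  by rewrite lerXn2r ?nnegrE ?expR_ge0 // (le_trans _ step) ?expR_ge0.
rewrite -expRM_natr mulrC; apply: expR_ge1Dxn; exact: mulr_ge0.
Qed.

(** In [sb_sum_exp_le], r of order n y makes a of order y^2, and the sum is then of order r
    y^{-2(k+1)}, that is n x^{2k+1}. *)
Lemma sb_sum_pow_le k : exists2 C : R, 0 <= C & forall t n, subcritical t n ->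
  sb_sum t n (fun m => m%:R ^+ k.+1) <= C * n%:R * (gap t n)^-1 ^+ (2 * k).+1.
Proof.
exists (4 ^+ k.+1 + k.+1`!%:R * 4 ^+ k.+1 * 4 ^+ k.+1).
  by rewrite addr_ge0 // !mulr_ge0 // ?exprn_ge0.
move=> t n D; have [n0 t0 nt] := D; have y0 := gap_gt0 D; have y1 := gap_le1 D.
have n0' : 0 < (n%:R : R) by rewrite ltr0n.
have x1 := gap_inv_ge1 D; set x := (gap t n)^-1 in x1 *.
have x0 : 0 <= x by rewrite (le_trans ler01).
rewrite !mulrDl.
(* If n y < 4, then m <= n <= 4 x suffices; here the choice of r below could give 0. *)
have [ny|ny] := ltP (n%:R * gap t n) 4.
  apply: (@le_trans _ _ (4 ^+ k.+1 * n%:R * x ^+ (2 * k).+1)); last first.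
    by rewrite lerDl !mulr_ge0 ?exprn_ge0.
  apply: (@le_trans _ _ (sb_sum t n (fun=> (4 * x) ^+ k.+1))).
    apply: sb_sum_le => // m /andP[_ le_mn]; apply: lerXn2r; rewrite ?nnegrE //.
      by rewrite mulr_ge0.
    apply: (@le_trans _ _ n%:R); first by rewrite ler_nat.
    by rewrite /x ler_pdivlMr // ltW.
  rewrite sb_sum_cst exprMn -!mulrA ler_wpM2l ?exprn_ge0 // mulrC ler_wpM2l //.
  by apply: ler_weXn2l => //; lia.
have ek : (2 * k).+1 = (k.+1 + k)%N by lia.
(* The integer part of n y / 2 is at least n y / 4 because n y >= 4; this gives 4 x r / n >= 1. *)
set r := Num.truncn (n%:R * gap t n / 2).
have /andP[r1 r2] : r%:R <= n%:R * gap t n / 2 < r.+1%:R.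
  by apply: truncn_itv; lra.
have r3 : n%:R * gap t n / 4 <= r%:R by move: r2 ny; rewrite -[r.+1%:R]natr1; lra.
have ru : r%:R / n%:R <= gap t n / 2 by rewrite ler_pdivrMr // mulrAC [_ * n%:R]mulrC.
have := sb_sum_exp_le k D ru; set a := _ / 4.
have r0 : 0 < r%:R :> R by apply: lt_le_trans r3; rewrite divr_gt0 // mulr_gt0.
have xy : x * gap t n = 1 by rewrite mulVf ?gt_eqF.
have u0 : 0 < r%:R / n%:R :> R by rewrite divr_gt0.
have a0 : 0 < a by rewrite /a divr_gt0 // mulr_gt0.
have ax : a * (4 * x) = r%:R / n%:R.
  transitivity (r%:R / n%:R * (x * gap t n)); last by rewrite xy mulr1.
  by rewrite /a; clearbody x; move: (r%:R / n%:R) => u; field.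
clearbody a.
have ux : 1 <= 4 * x * (r%:R / n%:R).
  rewrite mulrA ler_pdivlMr // mul1r; have := ler_wpM2l x0 r3.
  have -> : x * (n%:R * gap t n / 4) = n%:R / 4.
    transitivity (n%:R * (x * gap t n) / 4); last by rewrite xy mulr1.
    by clearbody x; field.
  by clearbody x; lra.
move=> H; have {}H : a ^+ k.+1 * sb_sum t n (fun m => m%:R ^+ k.+1) <= k.+1`!%:R * r%:R.
  by rewrite -sb_sumZ; apply: le_trans H; apply: sb_sum_le => // m _; rewrite [X in _ <= X]exprMn.
rewrite -(ler_pM2l (exprn_gt0 k.+1 a0)); apply: le_trans H _.
apply: (@le_trans _ _ (a ^+ k.+1 *
    (k.+1`!%:R * 4 ^+ k.+1 * 4 ^+ k.+1 * n%:R * x ^+ (2 * k).+1))); last first.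
  rewrite ler_wpM2l ?exprn_ge0 // ?(ltW a0) // lerDr !mulr_ge0 ?exprn_ge0 //.
rewrite (_ : _ * _ = k.+1`!%:R * n%:R * 4 * ((a * (4 * x)) ^+ k.+1 * (4 * x) ^+ k)); last first.
  rewrite ek exprD.
  rewrite !exprMn (exprS 4 k).
  by move: (k.+1`!%:R) (n%:R) (4 ^+ k) (x ^+ k) (x ^+ k.+1) (a ^+ k.+1) => f N F u v w; ring.
rewrite ax exprS -[_ * _ ^+ k * _ ^+ k]mulrA -exprMn.
apply: (@le_trans _ _ (k.+1`!%:R * n%:R * (r%:R / n%:R))).
  by rewrite (_ : _ * _ * (_ / _) = k.+1`!%:R * r%:R) //; field; rewrite gt_eqF.
have P : 1 <= (r%:R / n%:R * (4 * x)) ^+ k by rewrite exprn_ege1 // mulrC.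
rewrite -(mulrA (_ * n%:R)); apply: ler_wpM2l; first by rewrite mulr_ge0.
have := ler_wpM2l (ltW u0) P; move: u0.
by move: (r%:R / n%:R) ((_ * _) ^+ k) => u p; lra.
Qed.

End MomentBounds.

(** * Error terms graded by weight *)

Section ErrorClass.
Variable R : realType.
Implicit Types (t v : R) (m s w : nat) (f : R -> R -> nat -> R) (h : R -> nat -> R).

(** The range tm <= 1 covers all component sizes m <= n when nt < 1. *)
Definition coef_bound h b c :=
  exists2 C : R, 0 <= C &
    forall t m, 0 <= t -> t * m%:R <= 1 -> `|h t m| <= C * (t ^+ c * m%:R ^+ b).

(* Sums of terms [y^a h(t, m)], [y = 1 - v t], with [h] of order [t^c m^b]: giving
   [y], [m], [t] the weights -1, 2, -3, the weight of each term is at most [w],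
   and [s] powers of [t] are available. *)
Inductive err_class s w : (R -> R -> nat -> R) -> Prop :=
| err_term a b c h f of (s <= c)%N & (2 * b <= w + a + 3 * c)%N &
    coef_bound h b c & (forall t v m, f t v m = (1 - v * t) ^+ a * h t m) :
    err_class s w f
| err_add f g f' of err_class s w f & err_class s w g &
    (forall t v m, f' t v m = f t v m + g t v m) : err_class s w f'.

Lemma err_ext s w f f' : err_class s w f ->
  (forall t v m, f' t v m = f t v m) -> err_class s w f'.
Proof.
move=> fE; elim: fE f' => [a b c h {}f sc wt hb ff f' f'f|f1 f2 {}f H1 IH1 H2 IH2 ff f' f'f].
  by apply: (err_term sc wt hb) => t v m; rewrite f'f ff.
by apply: (err_add H1 H2) => t v m; rewrite f'f ff.
Qed.

Lemma err_le s w s' w' f : (s' <= s)%N -> (w <= w')%N ->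
  err_class s w f -> err_class s' w' f.
Proof.
move=> ss ww; elim=> [a b c h {}f sc wt hb ff|f1 f2 {}f _ IH1 _ IH2 ff].
  by apply: (err_term _ _ hb ff); lia.
exact: err_add IH1 IH2 ff.
Qed.

Lemma coef_boundM h h' b c b' c' : coef_bound h b c -> coef_bound h' b' c' ->
  coef_bound (fun t m => h t m * h' t m) (b + b') (c + c').
Proof.
move=> [C C0 hC] [C' C'0 hC']; exists (C * C'); first exact: mulr_ge0.
move=> t m t0 tm; rewrite normrM !exprD.
rewrite (_ : C * C' * _ = (C * (t ^+ c * m%:R ^+ b)) * (C' * (t ^+ c' * m%:R ^+ b'))); last by ring.
by apply: ler_pM => //; [apply: hC | apply: hC'].
Qed.

Lemma coef_bound_cst a : coef_bound (fun _ _ => a) 0 0.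
Proof. by exists `|a| => // t m _ _; rewrite !expr0 !mulr1. Qed.

Lemma coef_bound_t : coef_bound (fun t _ => t) 0 1.
Proof. by exists 1 => // t m t0 _; rewrite expr1 expr0 mulr1 mul1r ger0_norm. Qed.

Lemma coef_bound_pow b : coef_bound (fun _ m => m%:R ^+ b) b 0.
Proof. by exists 1 => // t m t0 _; rewrite expr0 !mul1r ger0_norm // exprn_ge0. Qed.

Lemma coef_boundD h h' b c : coef_bound h b c -> coef_bound h' b c ->
  coef_bound (fun t m => h t m + h' t m) b c.
Proof.
move=> [C C0 hC] [C' C'0 hC']; exists (C + C'); first exact: addr_ge0.
move=> t m t0 tm; rewrite mulrDl; apply: le_trans (ler_normD _ _) _.
by apply: lerD; [apply: hC | apply: hC'].
Qed.

Lemma err_mul s w f h b c s' w' : coef_bound h b c ->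
  (s' <= s + c)%N -> (2 * b + w <= w' + 3 * c)%N -> err_class s w f ->
  err_class s' w' (fun t v m => h t m * f t v m).
Proof.
move=> hb ss ww; elim=> [a b' c' h' {}f sc wt hb' ff|f1 f2 {}f _ IH1 _ IH2 ff].
  apply: (err_term (a := a) _ _ (coef_boundM hb hb')); [lia|lia|].
  by move=> t v m; rewrite ff; ring.
by apply: err_add IH1 IH2 _ => t v m; rewrite ff; ring.
Qed.

Lemma err_cst s w f a : err_class s w f -> err_class s w (fun t v m => a * f t v m).
Proof. by move=> fE; apply: (err_mul (coef_bound_cst a) _ _ fE); lia. Qed.

Lemma err_mulgap s w f : err_class s w.+1 f ->
  err_class s w (fun t v m => (1 - v * t) * f t v m).
Proof.
elim=> [a b' c' h' {}f sc wt hb' ff|f1 f2 {}f _ IH1 _ IH2 ff].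
  apply: (err_term (a := a.+1) _ _ hb'); [lia|lia|].
  by move=> t v m; rewrite ff exprS mulrA.
by apply: err_add IH1 IH2 _ => t v m; rewrite ff; ring.
Qed.

Lemma err_mult s w f : err_class s (w + 3) f ->
  err_class s.+1 w (fun t v m => t * f t v m).
Proof. by move=> fE; apply: (err_mul coef_bound_t _ _ fE); lia. Qed.

(** y + t is the gap with one vertex fewer; t has weight -3, below the weight -1 of y, so y + t may
    be treated like y. *)
Lemma err_mulshift s w f : err_class s w.+1 f ->
  err_class s w (fun t v m => (1 - v * t + t) * f t v m).
Proof.
move=> fE; apply: (err_add (err_mulgap fE) (g := fun t v m => t * f t v m)).
  by apply: (err_mul coef_bound_t _ _ fE); lia.
by move=> t v m; rewrite mulrDl.
Qed.

Lemma err_mulgapX s w f a : err_class s (w + a) f ->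
  err_class s w (fun t v m => (1 - v * t) ^+ a * f t v m).
Proof.
elim: a w => [|a IH] w fE; first by rewrite addn0 in fE; apply: err_ext fE _ => *; rewrite mul1r.
have := err_mulgap (IH w.+1 _); rewrite addSnnS => /(_ fE) H.
by apply: err_ext H _ => t v m; rewrite exprS mulrA.
Qed.

Lemma err_mulshiftX s w f a : err_class s (w + a) f ->
  err_class s w (fun t v m => (1 - v * t + t) ^+ a * f t v m).
Proof.
elim: a w => [|a IH] w fE; first by rewrite addn0 in fE; apply: err_ext fE _ => *; rewrite mul1r.
have := err_mulshift (IH w.+1 _); rewrite addSnnS => /(_ fE) H.
by apply: err_ext H _ => t v m; rewrite exprS mulrA.
Qed.

(* [((y + t)^a - y^a) / t] as a polynomial in [y] and [t]. *)
Fixpoint diff_quot (a : nat) (y t : R) : R :=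
  if a is b.+1 then (y + t) * diff_quot b y t + y ^+ b else 0.

Lemma diff_quotE a y t : (y + t) ^+ a = y ^+ a + t * diff_quot a y t.
Proof. by elim: a => [|a IH] /=; rewrite ?expr0 ?mulr0 ?addr0 // !exprS IH; ring. Qed.

Lemma err_zero s w : err_class s w (fun _ _ _ => 0).
Proof.
apply: (@err_term s w 0 0 s (fun _ _ => 0)) => //.
  by exists 0 => // t m _ _; rewrite normr0 mul0r.
by move=> *; rewrite mulr0.
Qed.

(** [diff_quot a] behaves like y^{a-1}. *)
Lemma err_diff_quot s w f a : err_class s (w + a) f ->
  err_class s w.+1 (fun t v m => diff_quot a (1 - v * t) t * f t v m).
Proof.
elim: a w => [|a IH] w fE; first by apply: err_ext (err_zero _ _) _ => *; rewrite mul0r.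
rewrite -addSnnS in fE; have H := err_mulshift (IH w.+1 fE).
apply: (err_add H (err_mulgapX fE)) => t v m /=; ring.
Qed.

(** Removing a y^{a-1}, the value of [diff_quot] at t = 0, leaves a multiple of t. *)
Lemma err_diff_quot2 s w f a : err_class s (w + a).+1 f ->
  err_class s.+1 w (fun t v m =>
    (diff_quot a (1 - v * t) t - a%:R * (1 - v * t) ^+ a.-1) * f t v m).
Proof.
elim: a w => [|a IH] w fE.
  by apply: err_ext (err_zero _ _) _ => *; rewrite /= mul0r subrr mul0r.
have H : err_class s (w.+1 + a).+1 f by rewrite addSnnS.
have {}H := err_mulshift (IH w.+1 H).
have fE' : err_class s ((w + 3) + a.-1) f by apply: err_le fE => //; lia.
have K := err_cst a%:R (err_mult (err_mulgapX fE')).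
apply: (err_add H K) => t v m /=; case: a {IH fE H fE' K} => [|a] /=.
  by rewrite expr0; ring.
by rewrite exprS -natr1; ring.
Qed.

(** At z = 0 the quotient is 0 by convention, and [exp_remE] still holds there. *)
Definition exp_rem (z : R) : R := (expR z - 1 - z) / z ^+ 2.

Lemma exp_remE z : expR z = 1 + z + z ^+ 2 * exp_rem z.
Proof.
rewrite /exp_rem; have [->|z0] := eqVneq z 0; first by rewrite expR0; ring.
by field.
Qed.

Lemma exp_rem_le z : 0 <= z <= 1 -> `|exp_rem z| <= 2.
Proof.
move=> /andP[z0 z1]; have [->|zn0] := eqVneq z 0.
  by rewrite /exp_rem expr0n invr0 mulr0 normr0.
have zp : 0 < z by rewrite lt_def zn0.
have lo := expR_ge1Dx z.
have hi : expR z <= 1 + z + 2 * z ^+ 2.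
  have h0 : 0 < expR (z / 2) by exact: expR_gt0.
  have E : expR z = expR (z / 2) ^+ 2 by rewrite -expRM_natl; congr expR; field.
  have := expR_ge1Dx (- (z / 2)); rewrite expRN E.
  move: h0; move: (expR _) => e e0 H.
  have {}H : (1 - z / 2) * e <= 1.
    by have := ler_wpM2r (ltW e0) H; rewrite mulVf // gt_eqF.
  have e2 : e <= 1 + z / 2 + z ^+ 2 / 2.
    rewrite -(@ler_pM2l _ (1 - z / 2)); last by lra.
    by apply: le_trans H _; nra.
  have z3 : z ^+ 3 <= z ^+ 2 by apply: ler_wiXn2l.
  have z4 : z ^+ 4 <= z ^+ 2 by apply: ler_wiXn2l.
  apply: (@le_trans _ _ ((1 + z / 2 + z ^+ 2 / 2) ^+ 2)); last by lra.
  by apply: lerXn2r; rewrite ?nnegrE ?(ltW e0) // ; nra.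
rewrite /exp_rem ger0_norm; last by rewrite divr_ge0 ?exprn_ge0 //; lra.
by rewrite ler_pdivrMr ?exprn_gt0 //; lra.
Qed.

Lemma coef_bound_exp_rem : coef_bound (fun t m => exp_rem (t * m%:R)) 0 0.
Proof.
exists 2 => // t m t0 tm; rewrite !expr0 !mulr1; apply: exp_rem_le.
by rewrite tm mulr_ge0.
Qed.

(** Passing from v to v - 1 turns y into y + t. The difference of the two powers carries a factor t,
    which absorbs the free v through vt = 1 - y; e^{tm} is expanded to second order. The last two
    summands form the remainder. *)
Lemma transport_term a h t v m (y := 1 - v * t) (e := exp_rem (t * m%:R)) :
  transport (fun t v m => (1 - v * t) ^+ a * h t m) t v m =
  (y - 1) * (diff_quot a y t * h t m)
  + y * ((y + t) ^+ a * (m%:R ^+ 1 * h t m))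
  + (y + t) ^+ a * (t * (m%:R ^+ 2 * ((1 - e + t * m%:R * e) * h t m)))
  + y * ((y + t) ^+ a * (t * (m%:R ^+ 2 * (e * h t m)))).
Proof.
rewrite /transport (_ : 1 - (v - 1) * t = y + t); last by rewrite /y; ring.
rewrite exp_remE -/e -/y.
have D := diff_quotE a y t; set p := (y + t) ^+ a in D *.
have vt : v * t = 1 - y by rewrite /y; ring.
have -> : v * (y ^+ a * h t m) = v * p * h t m - (v * t) * diff_quot a y t * h t m.
  by rewrite D; ring.
rewrite vt; clearbody p y e.
have e1 : (v - m%:R) * (1 + t * m%:R + (t * m%:R) ^+ 2 * e) =
  v - m%:R + (1 - y) * m%:R - t * m%:R ^+ 2 + ((1 - y) - t * m%:R) * t * m%:R ^+ 2 * e.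
  by rewrite -vt; ring.
by rewrite e1; ring.
Qed.

(** Both summands carry t m^2, of weight -3 + 4 = 1; the factors [C] and [exp_rem] are bounded for
    tm <= 1. *)
Lemma err_transport_rem s w a h (C := fun t m => 1 - exp_rem (t * m%:R)
      + t * m%:R * exp_rem (t * m%:R)) :
  err_class s (w + a) (fun t _ m => h t m) ->
  err_class s.+1 w.+1 (fun t v m =>
    (1 - v * t + t) ^+ a * (t * (m%:R ^+ 2 * (C t m * h t m)))
    + (1 - v * t) * ((1 - v * t + t) ^+ a *
        (t * (m%:R ^+ 2 * (exp_rem (t * m%:R) * h t m))))).
Proof.
move=> hE.
have bC : coef_bound C 0 0.
  have b1 := coef_boundM (coef_bound_cst (-1)) coef_bound_exp_rem.
  have b2 : coef_bound (fun t m => t * m%:R * exp_rem (t * m%:R)) 0 0.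
    have [K K0 KP] := coef_bound_exp_rem; exists K => // t m t0 tm.
    rewrite normrM; apply: le_trans (KP t m t0 tm).
    by rewrite ler_piMl // ger0_norm // mulr_ge0.
  have [K K0 KP] := coef_boundD (coef_boundD (coef_bound_cst 1) b1) b2.
  by exists K => // t m t0 tm; rewrite /C -mulN1r; apply: KP.
have H g : coef_bound g 0 0 -> err_class s.+1 w.+1 (fun t v m =>
    (1 - v * t + t) ^+ a * (t * (m%:R ^+ 2 * (g t m * h t m)))).
  move=> bg; apply: err_mulshiftX; apply: err_mult.
  apply: (err_mul (coef_bound_pow 2) (s := s) (w := w + a)); [lia|lia|].
  by apply: (err_mul bg _ _ hE); lia.
apply: (err_add (H _ bC) (g := fun t v m => (1 - v * t) * ((1 - v * t + t) ^+ a *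
        (t * (m%:R ^+ 2 * (exp_rem (t * m%:R) * h t m)))))) => //.
by apply: err_mulgap; apply: err_le (H _ coef_bound_exp_rem); lia.
Qed.

(** Multiplication by y m, the loss of one factor y in [diff_quot], and the remainder each raise the
    weight by at most 1. *)
Lemma err_transport s w f : err_class s w f -> err_class s w.+1 (transport f).
Proof.
elim=> [a b c h {}f sc wt hb ff|f1 f2 {}f _ IH1 _ IH2 ff]; last first.
  by apply: (err_add IH1 IH2) => t v m; rewrite /transport !ff; ring.
have hE : err_class s (w + a) (fun t _ m => h t m).
  by apply: (err_term (a := 0) sc _ hb) => [|*]; [lia|rewrite expr0 mul1r].
have rem := err_le (leqnSn s) (leqnn _) (err_transport_rem hE).
have dq := err_diff_quot hE.
have dqy : err_class s w.+1 (fun t v m => (1 - v * t) * (diff_quot a (1 - v * t) t * h t m)).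
  by apply: err_mulgap; apply: err_le dq; lia.
have m1 : err_class s (w.+2 + a) (fun t _ m => m%:R ^+ 1 * h t m).
  by apply: (err_mul (coef_bound_pow 1) _ _ hE); lia.
have main := err_mulgap (err_mulshiftX m1).
apply: (err_add (err_add (err_add dqy (err_cst (-1) dq) (fun _ _ _ => erefl)) main
  (fun _ _ _ => erefl)) rem) => t v m /=.
have -> : transport f t v m = transport (fun t v m => (1 - v * t) ^+ a * h t m) t v m.
  by rewrite /transport !ff.
by rewrite transport_term; ring.
Qed.

(* The subtracted polynomial is [ostep] applied to [y^a m^b]. *)
Lemma err_transport_main w a b : (2 * b <= w + a)%N ->
  err_class 1 w.+1 (fun t v m =>
    transport (fun t v m => (1 - v * t) ^+ a * m%:R ^+ b) t v m
    - ((1 - v * t) ^+ a.+1 * m%:R ^+ b.+1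
       - a%:R * ((1 - v * t) ^+ a.-1 * m%:R ^+ b)
       + a%:R * ((1 - v * t) ^+ a * m%:R ^+ b))).
Proof.
move=> wt; pose h t m : R := m%:R ^+ b.
have hE : err_class 0 (w + a) (fun t _ m => h t m).
  apply: (err_term (a := 0) (leq0n 0) _ (coef_bound_pow b)) => [|*]; first by lia.
  by rewrite expr0 mul1r.
have rem := err_transport_rem hE.
have dq : err_class 1 w.+1 (fun t v m =>
   (diff_quot a (1 - v * t) t - a%:R * (1 - v * t) ^+ a.-1) * h t m).
  by apply: err_diff_quot2; apply: err_le hE; lia.
have dqy : err_class 1 w.+1 (fun t v m => (1 - v * t) *
   ((diff_quot a (1 - v * t) t - a%:R * (1 - v * t) ^+ a.-1) * h t m)).
  by apply: err_mulgap; apply: err_diff_quot2; apply: err_le hE; lia.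
have m1 : err_class 0 (w.+2 + a) (fun t _ m => m%:R ^+ 1 * h t m).
  by apply: (err_mul (coef_bound_pow 1) _ _ hE); lia.
have main : err_class 1 w.+1 (fun t v m => (1 - v * t) *
    (t * (diff_quot a (1 - v * t) t * (m%:R ^+ 1 * h t m)))).
  have D3 := err_diff_quot m1; rewrite -addn3 in D3.
  apply: err_mulgap; apply: (err_le (leqnn _) _ (err_mult D3)); lia.
apply: (err_add (err_add (err_add dqy (err_cst (-1) dq) (fun _ _ _ => erefl)) main
  (fun _ _ _ => erefl)) rem) => t v m /=.
rewrite (transport_term a h) /h.
have := diff_quotE a (1 - v * t) t.
have -> : a%:R * ((1 - v * t) ^+ a * m%:R ^+ b) =
  (1 - v * t) * (a%:R * (1 - v * t) ^+ a.-1) * m%:R ^+ b :> R.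
  by case: (a) => [|a']; rewrite ?mul0r ?mulr0 ?mul0r // exprS; ring.
rewrite !exprS; move: (diff_quot _ _ _) ((1 - v * t) ^+ a.-1) ((1 - v * t) ^+ a) ((_ + t) ^+ a) => D p q r E.
by rewrite E; ring.
Qed.

Fixpoint transport_iter (k : nat) : R -> R -> nat -> R :=
  if k is j.+1 then transport (transport_iter j) else fun _ _ _ => 1.

Definition omono_fun k : R -> R -> nat -> R := fun t v m =>
  \sum_(u <- omono R k) u.1.1 * ((1 - v * t) ^+ u.1.2 * m%:R ^+ u.2).

Lemma err_sum (T : eqType) (l : seq T) s w (F : T -> R -> R -> nat -> R) :
  (forall u, u \in l -> err_class s w (F u)) ->
  err_class s w (fun t v m => \sum_(u <- l) F u t v m).
Proof.
elim: l => [|u l IH] FE.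
  by apply: err_ext (err_zero _ _) _ => *; rewrite big_nil.
have FE' := IH (fun x xl => FE x (mem_behead (s := u :: l) xl)).
by apply: (err_add (FE u (mem_head u l)) FE') => *; rewrite big_cons.
Qed.

(** By induction: [err_transport] carries the old error along, and [err_transport_main] compares L
    with [ostep] on each monomial, whose weight [omono_bound] controls. *)
Lemma err_transport_iter k :
  err_class 1 k (fun t v m => transport_iter k t v m - omono_fun k t v m).
Proof.
elim: k => [|k IH].
  apply: err_ext (err_zero _ _) _ => t v m /=.
  by rewrite /omono_fun big_seq1 /= !expr0 !mulr1 subrr.
have H : err_class 1 k.+1 (fun t v m => \sum_(u <- omono R k) u.1.1 *
   (transport (fun t v m => (1 - v * t) ^+ u.1.2 * m%:R ^+ u.2) t v m
    - ((1 - v * t) ^+ u.1.2.+1 * m%:R ^+ u.2.+1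
       - u.1.2%:R * ((1 - v * t) ^+ u.1.2.-1 * m%:R ^+ u.2)
       + u.1.2%:R * ((1 - v * t) ^+ u.1.2 * m%:R ^+ u.2)))).
  apply: err_sum => u /(allP (omono_bound R k)) /andP[_ H].
  by apply: err_cst; apply: err_transport_main; rewrite mul2n.
apply: (err_add (err_transport IH) H) => t v m /=.
have -> : transport (fun t v m => transport_iter k t v m - omono_fun k t v m) t v m =
    transport (transport_iter k) t v m - transport (omono_fun k) t v m.
  by rewrite /transport; ring.
have {H} E : transport (omono_fun k) t v m - \sum_(u <- omono R k) u.1.1 *
   (transport (fun t v m => (1 - v * t) ^+ u.1.2 * m%:R ^+ u.2) t v m
    - ((1 - v * t) ^+ u.1.2.+1 * m%:R ^+ u.2.+1
       - u.1.2%:R * ((1 - v * t) ^+ u.1.2.-1 * m%:R ^+ u.2)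
       + u.1.2%:R * ((1 - v * t) ^+ u.1.2 * m%:R ^+ u.2))) = omono_fun k.+1 t v m.
  have -> : transport (omono_fun k) t v m = \sum_(u <- omono R k) u.1.1 *
      transport (fun t v m => (1 - v * t) ^+ u.1.2 * m%:R ^+ u.2) t v m.
    by rewrite /transport /omono_fun !mulr_sumr -sumrB; apply: eq_bigr => u _; ring.
  rewrite -sumrB /omono_fun /= big_flatten big_map /=; apply: eq_bigr => -[[c i] j] _.
  rewrite !big_cons big_nil /= -!(mulr_natl c).
  by move: (transport _ _ _ _) => T; ring.
by rewrite -E; move: (transport (omono_fun k) t v m) (\sum_(u <- _) _) => a b; ring.
Qed.

End ErrorClass.

(** * Asymptotics of the size-biased moments *)

Section MomentAsymptotics.
Variable R : realType.
Implicit Types (t : R) (n m k : nat).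

Lemma gap_pow_le t n p q r : subcritical t n -> (q <= p + r)%N ->
  gap t n ^+ p * (gap t n)^-1 ^+ q <= (gap t n)^-1 ^+ r.
Proof.
move=> D qpr; have y0 := gap_gt0 D; have x1 := gap_inv_ge1 D.
apply: (@le_trans _ _ (gap t n ^+ p * (gap t n)^-1 ^+ (p + r))).
  by rewrite ler_wpM2l ?exprn_ge0 ?(ltW y0) // ler_weXn2l.
by rewrite exprD mulrA -exprMn divff ?gt_eqF // expr1n mul1r.
Qed.

Lemma horner_le (p : {poly R}) : exists2 C : R, 0 <= C &
  forall x, 1 <= x -> `|p.[x]| <= C * x ^+ (size p).-1.
Proof.
exists (\sum_(i < size p) `|p`_i|); first exact: sumr_ge0.
move=> x x1; rewrite horner_coef mulr_suml; apply: le_trans (ler_norm_sum _ _ _) _.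
apply: ler_sum => i _; rewrite normrM ler_wpM2l //.
rewrite ger0_norm; last by rewrite exprn_ge0 // (le_trans ler01).
by apply: ler_weXn2l => //; case: (size p) i => [[]|s i] //=; rewrite -ltnS.
Qed.

(** The mean of m^b is O(x^{2b-1}) for b > 0, and t <= y^3 trades each power of t beyond the first
    for three factors y. Keeping one t costs 3 in the exponent, whence w + 3 - 1. *)
Lemma sb_sum_err w f : err_class 1 w f ->
  unif_bound (fun t n => subcritical t n /\ t <= gap t n ^+ 3)
    (fun t n => sb_sum t n (f t n%:R) / n%:R) (fun t n => t * (gap t n)^-1 ^+ w.+2).
Proof.
elim=> [a b c h {}f sc wt [C C0 hb] ff|f1 f2 {}f _ IH1 _ IH2 ff]; last first.
  have [C C0 H] := unif_bound_add IH1 IH2; exists C => // t n D.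
  rewrite (_ : sb_sum _ _ _ / _ = sb_sum t n (f1 t n%:R) / n%:R + sb_sum t n (f2 t n%:R) / n%:R).
    exact: H.
  by rewrite -mulrDl -sb_sumD; congr (_ / _); apply: eq_bigr => m _; rewrite ff.
(* For b = 0 the exponent truncates to 0, in accordance with the mean 1 of a constant. *)
have [K K0 HK] : exists2 K : R, 0 <= K & forall t n, subcritical t n ->
    sb_sum t n (fun m => m%:R ^+ b) <= K * n%:R * (gap t n)^-1 ^+ (2 * b).-1.
  case: (b) => [|b']; first by exists 1 => // t n _; rewrite (sb_sum_cst t n 1) mulr1.
  have [K K0 HK] := sb_sum_pow_le R b'; exists K => // t n D.
  by rewrite (_ : (2 * b'.+1).-1 = (2 * b').+1)%N ?HK //; lia.
exists (C * K); first exact: mulr_ge0.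
move=> t n [D ty]; have [n0 t0 nt] := D; have y0 := gap_gt0 D.
have n0' : 0 < (n%:R : R) by rewrite ltr0n.
have x0 : 0 <= (gap t n)^-1 by rewrite (le_trans ler01) // gap_inv_ge1.
rewrite normrM normfV (ger0_norm (ltW n0')) ler_pdivrMr //.
apply: le_trans (sb_sum_norm _ _ t0) _.
apply: (@le_trans _ _ (sb_sum t n (fun m => gap t n ^+ a * C * t ^+ c * m%:R ^+ b))).
  apply: sb_sum_le => // m /andP[m0 le_mn]; rewrite ff normrM -!mulrA.
  rewrite ger0_norm ?exprn_ge0 ?(ltW y0) // ler_wpM2l ?exprn_ge0 ?(ltW y0) //.
  apply: hb => //; apply: le_trans (ltW nt).
  by rewrite mulrC ler_wpM2r // ler_nat.
rewrite sb_sumZ; apply: le_trans (ler_wpM2l _ (HK t n D)) _.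
  by rewrite !mulr_ge0 ?exprn_ge0 // ltW.
have tc : t ^+ c <= t * gap t n ^+ (3 * c.-1).
  case: (c) sc => // c' _; rewrite exprS ler_wpM2l // exprM.
  by apply: lerXn2r; rewrite ?nnegrE ?exprn_ge0 // ltW.
rewrite [X in X <= _](_ : _ = C * K * n%:R * (t ^+ c * (gap t n ^+ a * (gap t n)^-1 ^+ (2 * b).-1))); last by ring.
rewrite [X in _ <= X](_ : _ = C * K * n%:R * (t * (gap t n)^-1 ^+ w.+2)); last by ring.
apply: ler_wpM2l; first by rewrite !mulr_ge0.
apply: (@le_trans _ _ (t * gap t n ^+ (3 * c.-1) * (gap t n ^+ a * (gap t n)^-1 ^+ (2 * b).-1))).
  by apply: ler_wpM2r => //; rewrite mulr_ge0 ?exprn_ge0 // ltW.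
rewrite -mulrA ler_wpM2l // mulrA -exprD; apply: gap_pow_le => //; lia.
Qed.

(** By [sb_sum_transport] the new value is n+1 times the difference (n+1) - n of the previous
    ones. *)
Lemma sb_sum_transport_iter k t n : sb_sum t n (transport_iter k t n%:R) = n%:R.
Proof.
elim: k n => [|k IH] n; first exact: sb_sum1.
case: n => [|n]; first by rewrite /sb_sum big_ord1 !mul0r.
rewrite [transport_iter _]/= sb_sum_transport !IH.
by rewrite -natr1 [n%:R + 1]addrC addrK mulr1.
Qed.

Definition sb_moment k t n : R := sb_sum t n (fun m => m%:R ^+ k) / n%:R.

Definition moment_dev k t n : R := sb_moment k t n - (borel_poly R k).[(gap t n)^-1].

(** By [omono_pairing] the main terms B_j(x) contribute exactly the subtracted 1, so only the
    deviations of the moments remain. *)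
Lemma omono_dev k t n : subcritical t n ->
  sb_sum t n (omono_fun k t n%:R) / n%:R - 1 =
  \sum_(u <- omono R k) u.1.1 * (gap t n ^+ u.1.2 * moment_dev u.2 t n).
Proof.
move=> D; have y0 := gap_gt0 D.
have E : \sum_(u <- omono R k) u.1.1 * (gap t n ^+ u.1.2 * (borel_poly R u.2).[(gap t n)^-1]) = 1.
  have := congr1 (fun p : {poly R} => gap t n ^+ k * p.[(gap t n)^-1]) (omono_pairing R k).
  rewrite hornerXn -exprMn divff ?gt_eqF // expr1n => <-.
  rewrite horner_sum mulr_sumr big_seq [RHS]big_seq; apply: eq_bigr => u.
  move=> /(allP (omono_bound R k)) /andP[uk _].
  rewrite hornerZ hornerM hornerXn [RHS]mulrCA; congr (_ * _); rewrite [RHS]mulrA; congr (_ * _).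
  by rewrite -{1}(subnKC uk) exprD -mulrA -exprMn divff ?gt_eqF // expr1n mulr1.
rewrite -[X in _ - X]E /sb_sum /omono_fun.
under eq_bigr do rewrite mulr_sumr.
rewrite exchange_big mulr_suml -sumrB; apply: eq_bigr => u _ /=.
rewrite /moment_dev /sb_moment /sb_sum mulrBr mulrBr; congr (_ - _).
rewrite !mulr_suml !mulr_sumr; apply: eq_bigr => m _; rewrite -/(gap t n).
by move: (gap t n ^+ _) (m%:R ^+ _) => a b; ring.
Qed.

(* By induction on [k]: [omono k] has leading term [y^k m^k], and [t x^3 <= 1] makes
   higher powers of [t] in the error terms harmless. *)
Lemma unif_bound_moment_dev_low k :
  unif_bound (fun t n => subcritical t n /\ t <= gap t n ^+ 3)
    (moment_dev k) (fun t n => t * (gap t n)^-1 ^+ (2 * k).+2).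
Proof.
set dom := (X in unif_bound X).
have x0 t n : dom t n -> 0 <= (gap t n)^-1.
  by case=> D _; rewrite (le_trans ler01) // gap_inv_ge1.
elim/ltn_ind: k => k IH.
have [s [sE sk]] := omono_head R k.
(* L^k 1 has mean exactly 1, so the mean of [omono_fun k] misses 1 only by an error of weight k. *)
have tot : unif_bound dom (fun t n => \sum_(u <- omono R k) u.1.1 * (gap t n ^+ u.1.2 * moment_dev u.2 t n))
    (fun t n => t * (gap t n)^-1 ^+ k.+2).
  have [C C0 H] := sb_sum_err (err_transport_iter R k); exists C => // t n D.
  have [[n0 _ _] _] := D.
  rewrite -omono_dev; last by case: D.
  apply: le_trans (H t n D); rewrite -normrN le_eqVlt; apply/orP; left.
  apply/eqP; congr (`|_|).
  rewrite (_ : (fun m => _) = (fun m => transport_iter k t n%:R m + -1 * omono_fun k t n%:R m)); last first.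
    by apply/funext => m; rewrite mulN1r.
  rewrite sb_sumD sb_sumZ sb_sum_transport_iter mulrDl divff ?pnatr_eq0 -?lt0n //.
  by rewrite mulN1r mulNr opprB.
(* A lower term y^i m^j has 2j - i <= k, so the induction hypothesis yields the exponent 2j + 2 - i
   <= k + 2. *)
have low : unif_bound dom (fun t n => \sum_(u <- s) u.1.1 * (gap t n ^+ u.1.2 * moment_dev u.2 t n))
    (fun t n => t * (gap t n)^-1 ^+ k.+2).
  apply: unif_bound_sum => [t n D|u us].
    by rewrite mulr_ge0 ?exprn_ge0 ?x0 //; case: D => -[].
  have [C C0 H] := IH _ (allP sk u us); exists (`|u.1.1| * C); first exact: mulr_ge0.
  move=> t n D; have [[n0 t0 nt] _] := D; rewrite !normrM -mulrA ler_wpM2l //.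
  have y0 : 0 < gap t n by apply: gap_gt0; case: D.
  rewrite (ger0_norm (exprn_ge0 _ (ltW y0))).
  apply: le_trans (ler_wpM2l _ (H t n D)) _; first by rewrite exprn_ge0 // ltW.
  rewrite [X in X <= _](_ : _ = C * (t * (gap t n ^+ u.1.2 * (gap t n)^-1 ^+ (2 * u.2).+2))); last by ring.
  rewrite !ler_wpM2l //; apply: gap_pow_le; first by case: D.
  have /(allP (omono_bound R k)) /andP[_] : u \in omono R k by rewrite sE inE us orbT.
  by move: (u.2) (u.1.2) => j i; lia.
have [C C0 HC] := tot; have [C' C'0 HC'] := low.
exists (C + C'); first exact: addr_ge0.
move=> t n D; have y0 : 0 < gap t n by apply: gap_gt0; case: D.
(* Isolating the leading term and dividing by y^k costs x^k, which brings the exponent to 2k + 2. *)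
have E : moment_dev k t n = (gap t n)^-1 ^+ k *
   (\sum_(u <- omono R k) u.1.1 * (gap t n ^+ u.1.2 * moment_dev u.2 t n)
    - \sum_(u <- s) u.1.1 * (gap t n ^+ u.1.2 * moment_dev u.2 t n)).
  rewrite sE big_cons /= addrK mul1r mulrA -exprMn mulVf ?gt_eqF //.
  by rewrite expr1n mul1r.
rewrite E normrM ger0_norm ?exprn_ge0 ?x0 //.
rewrite (_ : (2 * k).+2 = k + k.+2)%N; last by lia.
rewrite exprD [t * _]mulrCA [X in _ <= X]mulrCA ler_wpM2l ?exprn_ge0 ?x0 // mulrDl.
apply: le_trans (ler_normB _ _) _; apply: lerD; [exact: HC|exact: HC'].
Qed.

Lemma sb_moment_le k : exists2 C : R, 0 <= C & forall t n, subcritical t n ->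
  0 <= sb_moment k.+1 t n <= C * (gap t n)^-1 ^+ (2 * k).+1.
Proof.
have [C C0 H] := sb_sum_pow_le R k; exists C => // t n D; have [n0 t0 nt] := D.
have n0' : 0 < (n%:R : R) by rewrite ltr0n.
rewrite /sb_moment divr_ge0 //=; last first.
  rewrite -(_ : sb_sum t n (fun=> 0) = 0); last by rewrite sb_sum_cst mul0r.
  by apply: sb_sum_le => // m _; rewrite exprn_ge0.
by rewrite ler_pdivrMr // mulrAC; apply: H.
Qed.

(* If [t x^3 > 1] the claimed error exceeds both [sb_moment k] and [borel_poly k]. *)
Lemma unif_bound_moment_dev k :
  unif_bound (@subcritical R) (moment_dev k) (fun t n => t * (gap t n)^-1 ^+ (2 * k).+2).
Proof.
case: k => [|k].
  exists 0 => // t n [n0 t0 nt]; rewrite mul0r normr_le0 /moment_dev /sb_moment.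
  by rewrite (sb_sum_cst t n 1) mul1r divff ?pnatr_eq0 -?lt0n // borel_poly0 hornerC subrr.
have [C C0 HC] := unif_bound_moment_dev_low k.+1.
have [K K0 HK] := sb_moment_le k; have [K' K'0 HK'] := horner_le (borel_poly R k.+1).
exists (C + (K + K')); first by rewrite !addr_ge0.
move=> t n D; have [n0 t0 nt] := D; have y0 := gap_gt0 D; have x1 := gap_inv_ge1 D.
have x0 j : 0 <= (gap t n)^-1 ^+ j by rewrite exprn_ge0 // (le_trans ler01).
have b0 : 0 <= t * (gap t n)^-1 ^+ (2 * k.+1).+2 by apply: mulr_ge0.
rewrite mulrDl; have [ty|ty] := leP t (gap t n ^+ 3).
  by apply: le_trans (HC t n (conj D ty)) _; rewrite lerDl mulr_ge0 ?addr_ge0.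
rewrite -[X in X <= _]add0r; apply: lerD; first by rewrite mulr_ge0.
apply: (@le_trans _ _ ((K + K') * (gap t n)^-1 ^+ (2 * k).+1)).
  have /andP[g0 g1] := HK t n D.
  rewrite /moment_dev mulrDl; apply: le_trans (ler_normB _ _) _; apply: lerD.
    by rewrite ger0_norm.
  apply: le_trans (HK' _ x1) _; rewrite ler_wpM2l //; apply: ler_weXn2l => //.
  have : (size (borel_poly R k.+1) <= k.*2.+2)%N.
    by apply/leq_sizeP => i ij; apply: coef_borel_gt.
  by move: (size _) => sz; clear; lia.
rewrite ler_wpM2l ?addr_ge0 //.
apply: (@le_trans _ _ (gap t n ^+ 3 * (gap t n)^-1 ^+ (2 * k.+1).+2)).
  rewrite (_ : (2 * k.+1).+2 = 3 + (2 * k).+1)%N; last by lia.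
  by rewrite exprD mulrA -exprMn divff ?gt_eqF // expr1n mul1r.
by rewrite ler_wpM2r // ltW.
Qed.

End MomentAsymptotics.

(** * Covariance of the component sums *)

Section Clocks.
Context {d : measure_display} {Omega : measurableType d} {R : realType}.
Variables (P : probability Omega R) (n : nat) (T : pair_of n -> {RV P >-> R}).

Lemma exponential_prob_le (t : R) : 0 <= t ->
  exponential_prob 1 `]-oo, t]%classic = (1 - expR (- t))%:E.
Proof.
move=> t0.
transitivity (exponential_prob 1 `[0, t]%classic).
  rewrite /exponential_prob integral_mkcond [RHS]integral_mkcond.
  apply: eq_integral => x _; rewrite !patchE.
  have [x0|x0] := ltP x 0; first by rewrite lt0_exponential_pdf // !if_same.
  by rewrite !mem_setE !in_itv /= x0.
(* At t = 0 the interval degenerates to a single point, of measure zero. *)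
have [t1|t1] := ltP 0 t; first by rewrite exponential_prob_itv0c // mulN1r.
have -> : t = 0 by apply/eqP; rewrite eq_le t1.
by rewrite set_itv1 /exponential_prob integral_set1 oppr0 expR0 subrr.
Qed.

Definition open_edges (t : R) (w : Omega) : {set pair_of n} :=
  [set e | T e w <= t].

Hypothesis clocksT : exponential_clocks T.
Variable t : R.
Hypothesis t0 : 0 <= t.

Let clock_event (g : {set pair_of n}) (e : pair_of n) : set R :=
  if e \in g then `]-oo, t]%classic else (~` `]-oo, t])%classic.

Let open_edges_event g :
  (open_edges t @^-1` [set g] =
   \bigcap_(i in [set` [set: pair_of n]%SET]) (T i @^-1` clock_event g i))%classic.
Proof.
apply/seteqP; split => w /=.
  move=> wg e _; rewrite /= /clock_event -wg inE.
  by case: ifPn => /=; rewrite in_itv //= => /negP.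
move=> H; apply/setP => e; rewrite inE; have := H e; rewrite /= inE => /(_ isT).
by rewrite /clock_event; case: ifP => _ /=; rewrite in_itv //= => /negP/negbTE.
Qed.

Lemma measurable_open_edges g : measurable (open_edges t @^-1` [set g])%classic.
Proof.
rewrite open_edges_event; apply: fin_bigcap_measurable => // e _.
rewrite -[X in measurable X]setTI; apply: measurable_funPT => //.
by rewrite /clock_event; case: ifP => _ //; apply: measurableC.
Qed.

Lemma prob_open_edges g :
  P (open_edges t @^-1` [set g])%classic = (bern_wt (expR (- t)) g)%:E.
Proof.
have [indep law] := clocksT.
have mC e : measurable (clock_event g e).
  by rewrite /clock_event; case: ifP => _ //; apply: measurableC.
rewrite open_edges_event indep // /bern_wt -prodEFin.
apply: eq_big => e; first by rewrite inE.
move=> _; have lawe A : measurable A -> P (T e @^-1` A)%classic = exponential_prob 1 A.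
  by move=> mA; rewrite -(law e).
have mI : measurable (`]-oo, t]%classic : set R) by [].
rewrite /clock_event; case: ifP => _; first by rewrite lawe // exponential_prob_le.
have mTI : measurable (T e @^-1` `]-oo, t])%classic.
  by have := measurable_funPT (T e) measurableT _ mI; rewrite setTI.
have E : P (T e @^-1` ~` `]-oo, t])%classic = (1 - P (T e @^-1` `]-oo, t])%classic)%E.
  exact: probability_setC.
rewrite {}E (lawe _ mI) exponential_prob_le // -EFinB; congr EFin.
by rewrite opprB addrC subrK.
Qed.

(** [open_edges] takes finitely many values, so every function of it is a finite combination of
    indicators of measurable events. *)
Lemma expectation_open_edges (phi : {set pair_of n} -> R) :
  ('E_P[fun w => phi (open_edges t w)] = (bern_E (expR (- t)) phi)%:E)%E.
Proof.
rewrite unlock.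
transitivity (\int[P]_w \sum_(g : {set pair_of n})
    ((phi g)%:E * (\1_(open_edges t @^-1` [set g])%classic w)%:E))%E.
  apply: eq_integral => w _; rewrite (bigD1 (open_edges t w)) //= big1 ?adde0.
    by rewrite indicE mem_set // mule1.
  move=> g ng; rewrite indicE memNset ?mule0 //= => H.
  by move: ng; rewrite H eqxx.
have intI g : P.-integrable setT (fun w => (\1_(open_edges t @^-1` [set g])%classic w)%:E).
  by apply: integrable_indic => //; apply: measurable_open_edges.
rewrite integral_sum //; last by move=> g; apply: integrableZl.
rewrite /bern_E -sumEFin; apply: eq_bigr => g _.
rewrite integralZl // integral_indic //; last exact: measurable_open_edges.
rewrite setIT EFinM muleC; congr (_ * _)%E.
exact: prob_open_edges.
Qed.

Lemma covariance_S_process k l : (0 < k)%N -> (0 < l)%N ->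
  covariance P (S_process T k t) (S_process T l t) =
  (moment (expR (- t)) (k + l) n
   + \sum_(m < n.+1) m%:R ^+ k * comp_mean (expR (- t)) n m
                     * moment (expR (- t)) l (n - m)
   - moment (expR (- t)) k n * moment (expR (- t)) l n)%:E.
Proof.
move=> k0 l0.
have SE j w : S_process T j t w = (comp_sum j (adj (open_edges t w)))%:R.
  rewrite /S_process; congr (comp_sum _ _)%:R; apply/funext => x; apply/funext => y.
  by apply: eq_existsb => e; rewrite inE.
have ES j : (0 < j)%N ->
    ('E_P[S_process T j t] = (moment (expR (- t)) j n)%:E)%E.
  move=> j0; rewrite -(bern_E_comp_sum _ _ j0) -expectation_open_edges.
  by congr expectation; apply/funext => w; rewrite SE.
rewrite unlock !ES //=.
set a := moment _ k n; set b := moment _ l n.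
(* The centred product, expanded as a function of the set of open edges. *)
pose phi (g : {set pair_of n}) : R :=
  (comp_sum k (adj g))%:R * (comp_sum l (adj g))%:R
  + ((- b) * (comp_sum k (adj g))%:R + ((- a) * (comp_sum l (adj g))%:R + a * b)).
transitivity ('E_P[fun w => phi (open_edges t w)])%E.
  congr expectation; apply/funext => w; rewrite /phi -!SE.
  by rewrite [LHS](_ : _ = (S_process T k t w - a) * (S_process T l t w - b)) //; ring.
rewrite expectation_open_edges /phi !bern_E_D !bern_EZ bern_E_cst bern_E_comp_sum2 //.
by rewrite !bern_E_comp_sum // -/a -/b; congr EFin; ring.
Qed.

End Clocks.

(** * Increments in n and the expansion of the covariance *)

Section CovarianceAsymptotics.
Variable R : realType.
Implicit Types (t : R) (n m k l : nat).
Local Notation mom t l n := (moment (expR (- t)) l n).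

(** The constant is 1 + 2 + 2 + 2: in the remainder [exp_rem] is at most 2 in absolute value, and tm
    and 1 - vt lie between 0 and 1. *)
Lemma transport_pow b t (v : R) m : subcritical t m -> m%:R <= v -> v * t < 1 ->
  `|transport (fun _ _ m => m%:R ^+ b) t v m - (1 - v * t) * m%:R ^+ b.+1|
  <= 7 * t * m%:R ^+ b.+2.
Proof.
move=> [m0 t0 mt] mv vt.
pose h (_ : R) m : R := m%:R ^+ b.
have := transport_term 0 h t v m; rewrite /= /h.
rewrite (_ : transport _ t v m = transport (fun _ _ m => m%:R ^+ b) t v m); last first.
  by rewrite /transport !mul1r.
move=> ->; rewrite !expr0 mul0r mulr0 add0r !mul1r expr1.
have tm : 0 <= t * m%:R <= 1 by rewrite mulr_ge0 //= mulrC ltW.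
have := exp_rem_le tm; move: (exp_rem _) => e e2.
rewrite (_ : _ - _ = (1 - e + t * m%:R * e + (1 - v * t) * e) * (t * m%:R ^+ b.+2)); last first.
  by rewrite !exprS; ring.
have p0 : 0 <= t * m%:R ^+ b.+2 by rewrite mulr_ge0 ?exprn_ge0.
rewrite normrM (ger0_norm p0) -[7 * t * _]mulrA ler_wpM2r //.
have v0 : 0 <= v * t by rewrite mulr_ge0 // (le_trans _ mv).
case/andP: tm => tm0 tm1; move: (v * t) (t * m%:R) vt v0 tm0 tm1 => w z vt v0 tm0 tm1.
move: e2; rewrite !ler_norml => /andP[e1 e2]; apply/andP; split; nra.
Qed.

(** By [sb_sum_transport] the increment is the size-biased mean of L m^l, which is y times the mean
    of m^{l+1} up to O(t) times the mean of m^{l+2}. *)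
Lemma moment_increment l : exists2 C : R, 0 <= C & forall t n, subcritical t n.+1 ->
  `|mom t l.+1 n.+1 - mom t l.+1 n
    - gap t n.+1 * (borel_poly R l.+1).[(gap t n.+1)^-1]|
  <= C * (t * (gap t n.+1)^-1 ^+ (2 * l.+1).+1).
Proof.
have [C C0 HC] := unif_bound_moment_dev R l.+1.
have [K K0 HK] := sb_moment_le R l.+1.
exists (7 * K + C); first by rewrite addr_ge0 // mulr_ge0.
move=> t n D; have [n0 t0 nt] := D; have y0 := gap_gt0 D.
have n0' : 0 < (n.+1%:R : R) by rewrite ltr0n.
have E := sb_sum_transport (fun _ _ m => m%:R ^+ l) t n.
rewrite -!sb_sum_moment.
have -> : sb_sum t n.+1 (fun m => m%:R ^+ l) - sb_sum t n (fun m => m%:R ^+ l) =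
    sb_sum t n.+1 (transport (fun _ _ m => m%:R ^+ l) t n.+1%:R) / n.+1%:R.
  by rewrite E mulrC mulKf // gt_eqF.
set T := sb_sum _ _ (transport _ _ _).
have -> : T / n.+1%:R - gap t n.+1 * (borel_poly R l.+1).[(gap t n.+1)^-1] =
   (T - gap t n.+1 * sb_sum t n.+1 (fun m => m%:R ^+ l.+1)) / n.+1%:R
   + gap t n.+1 * moment_dev l.+1 t n.+1.
  by rewrite /moment_dev /sb_moment; field; rewrite gt_eqF.
rewrite [X in _ <= X]mulrDl; apply: le_trans (ler_normD _ _) _; apply: lerD.
  have -> : T - gap t n.+1 * sb_sum t n.+1 (fun m => m%:R ^+ l.+1) =
    sb_sum t n.+1 (fun m => transport (fun _ _ m => m%:R ^+ l) t n.+1%:R m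
      + - gap t n.+1 * m%:R ^+ l.+1).
    by rewrite sb_sumD sb_sumZ mulNr.
  have /andP[_ HK'] := HK t n.+1 D.
  apply: (@le_trans _ _ (7 * t * sb_moment l.+2 t n.+1)); last first.
    rewrite -!mulrA ler_wpM2l // [X in _ <= X]mulrCA ler_wpM2l //.
  rewrite normrM normfV (ger0_norm (ltW n0')) /sb_moment mulrA ler_wpM2r ?invr_ge0 ?(ltW n0') //.
  apply: le_trans (sb_sum_norm _ _ t0) _; rewrite -sb_sumZ; apply: sb_sum_le => // m /andP[m0 mn].
  rewrite mulNr; apply: transport_pow => //; last by rewrite ler_nat.
  by split=> //; apply: le_lt_trans nt; rewrite ler_wpM2r // ler_nat.
rewrite normrM (ger0_norm (ltW y0)); apply: le_trans (ler_wpM2l (ltW y0) (HC t n.+1 D)) _.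
rewrite [X in X <= _](_ : _ = C * (t * (gap t n.+1 * (gap t n.+1)^-1 * (gap t n.+1)^-1 ^+ (2 * l.+1).+1))).
  by rewrite divff ?gt_eqF // mul1r lexx.
by rewrite exprS; move: (_ ^-1) ((_ ^-1) ^+ _) => a b; ring.
Qed.

Lemma horner_lipschitz (p : {poly R}) d : (size p <= d.+2)%N -> exists2 C : R, 0 <= C &
  forall x z, 1 <= z <= x -> `|p.[x] - p.[z]| <= C * ((x - z) * x ^+ d).
Proof.
move=> sp; exists (\sum_(i < d.+2) `|p`_i| *+ i); first by apply: sumr_ge0 => i _; rewrite mulrn_wge0.
move=> x z /andP[z1 zx]; have z0 : 0 <= z by rewrite (le_trans ler01).
have x0 : 0 <= x by rewrite (le_trans z0).
rewrite !(horner_coef_wide _ sp) -sumrB mulr_suml; apply: le_trans (ler_norm_sum _ _ _) _.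
apply: ler_sum => i _; rewrite -mulrBr normrM mulrnAl -mulrnAr ler_wpM2l //.
rewrite subrXX normrM [`|x - z|]ger0_norm ?subr_ge0 // -mulrnAr ler_wpM2l ?subr_ge0 //.
apply: le_trans (ler_norm_sum _ _ _) _; rewrite -[X in _ *+ X]card_ord -sumr_const.
apply: ler_sum => j _; have lt_ji := ltn_ord j; have lt_id := ltn_ord i.
rewrite ger0_norm; last by rewrite mulr_ge0 ?exprn_ge0.
apply: (@le_trans _ _ (x ^+ (i.-1 - j) * x ^+ j)).
  by rewrite ler_wpM2l ?exprn_ge0 // lerXn2r.
rewrite -exprD; apply: ler_weXn2l; first exact: le_trans zx.
by clear -lt_ji lt_id; lia.
Qed.

(** The polynomial B_{l+1}(x)/x, approximate gain of f_{l+1} per added vertex. *)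
Definition moment_slope l : {poly R} :=
  borel_poly R l + 'X * ('X - 1) * (borel_poly R l)^`().

Lemma mulX_moment_slope l : 'X * moment_slope l = borel_poly R l.+1.
Proof. by rewrite borel_polyS /moment_slope; ring. Qed.

Lemma size_moment_slope l : (0 < l)%N -> (size (moment_slope l) <= (2 * l).+1)%N.
Proof.
case: l => // l _; apply/leq_sizeP => i li.
have -> : (moment_slope l.+1)`_i = (borel_poly R l.+2)`_i.+1.
  by rewrite -mulX_moment_slope coefXM.
by apply: coef_borel_gt; rewrite -mul2n; lia.
Qed.

Lemma horner_moment_slope l t n : subcritical t n ->
  gap t n * (borel_poly R l.+1).[(gap t n)^-1] = (moment_slope l).[(gap t n)^-1].
Proof.
move=> D; rewrite -mulX_moment_slope hornerM hornerX mulrA divff ?mul1r //.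
by rewrite gt_eqF // gap_gt0.
Qed.

(** Telescoping over single vertices. Deleting i vertices moves the inverse gap by at most i t x^2,
    hence the slope by O(i t x^{2l+1}); summing over i < m gives the m^2 term. *)
Lemma moment_decrement l : (0 < l)%N -> exists2 C : R, 0 <= C &
  forall t n m, subcritical t n -> (m <= n)%N ->
  `|mom t l.+1 n - mom t l.+1 (n - m) - m%:R * (moment_slope l).[(gap t n)^-1]|
  <= C * t * (m%:R * (gap t n)^-1 ^+ (2 * l.+1).+1
              + m%:R ^+ 2 * (gap t n)^-1 ^+ (2 * l).+1).
Proof.
move=> l0; have [C C0 HC] := moment_increment l.
have e2l : (2 * l).+1 = (2 + (2 * l).-1)%N by lia.
have sl : (size (moment_slope l) <= (2 * l).-1.+2)%N.
  by apply: leq_trans (size_moment_slope l0) _; lia.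
have [K K0 HK] := horner_lipschitz sl.
exists (C + K); first exact: addr_ge0.
move=> t n m D; have [n0 t0 nt] := D; have y0 := gap_gt0 D; have x1 := gap_inv_ge1 D.
set x := (gap t n)^-1 in x1 *; have x0 : 0 <= x by rewrite (le_trans ler01).
elim: m => [|m IH] lt_mn.
  by rewrite subn0 subrr !mul0r subrr expr0n mul0r addr0 mulr0 normr0.
have [n' nE] : exists n', (n - m)%N = n'.+1 by exists (n - m).-1; lia.
have mnt : m%:R * t <= n%:R * t by rewrite ler_wpM2r // ler_nat ltnW.
have gapE : gap t n'.+1 = gap t n + m%:R * t.
  by rewrite -nE /gap natrB ?(ltnW lt_mn) //; ring.
have D' : subcritical t n'.+1.
  by split=> //; apply: le_lt_trans nt; rewrite ler_wpM2r // ler_nat -nE leq_subr.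
have y'0 := gap_gt0 D'; have x'1 := gap_inv_ge1 D'.
have x'x : (gap t n'.+1)^-1 <= x.
  by rewrite lef_pV2 ?posrE // gapE lerDl mulr_ge0.
have -> : (n - m.+1 = n')%N by lia.
have := IH (ltnW lt_mn); rewrite nE => {}IH.
have inc := HC t n' D'; rewrite horner_moment_slope // in inc.
have lip := HK x (gap t n'.+1)^-1; rewrite x'1 x'x in lip; have {}lip := lip isT.
set Mn := mom t l.+1 n in IH *; set Mn1 := mom t l.+1 n'.+1 in IH inc; set Mn' := mom t l.+1 n' in inc *.
(* The three parts are the induction hypothesis, the increment at n - m vertices, and the change of
   slope between the two gaps. *)
have -> : Mn - Mn' - m.+1%:R * (moment_slope l).[x] =
  (Mn - Mn1 - m%:R * (moment_slope l).[x])
  + (Mn1 - Mn' - (moment_slope l).[(gap t n'.+1)^-1])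
  - ((moment_slope l).[x] - (moment_slope l).[(gap t n'.+1)^-1]).
  by rewrite -natr1; ring.
apply: le_trans (ler_normB _ _) _; apply: le_trans (lerD (ler_normD _ _) (lexx _)) _.
apply: le_trans (lerD (lerD IH inc) lip) _.
have b1 : (gap t n'.+1)^-1 ^+ (2 * l.+1).+1 <= x ^+ (2 * l.+1).+1.
  by apply: lerXn2r; rewrite ?nnegrE // (le_trans ler01).
have b2 : x - (gap t n'.+1)^-1 <= m%:R * t * x ^+ 2.
  have -> : x - (gap t n'.+1)^-1 = m%:R * t * (x * (gap t n'.+1)^-1).
    have -> : m%:R * t = gap t n'.+1 - gap t n by rewrite gapE addrC addKr.
    by rewrite /x; field; rewrite !gt_eqF.
  by rewrite ler_wpM2l ?mulr_ge0 // expr2 ler_wpM2l.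
have b3 : (x - (gap t n'.+1)^-1) * x ^+ (2 * l).-1 <= m%:R * t * x ^+ (2 * l).+1.
  have -> : x ^+ (2 * l).+1 = x ^+ 2 * x ^+ (2 * l).-1.
    by rewrite e2l exprD.
  by rewrite mulrA ler_wpM2r ?exprn_ge0.
apply: (@le_trans _ _ ((C + K) * t * (m%:R * x ^+ (2 * l.+1).+1 + m%:R ^+ 2 * x ^+ (2 * l).+1)
   + C * (t * x ^+ (2 * l.+1).+1) + K * (m%:R * t * x ^+ (2 * l).+1))).
  by rewrite !lerD // ?ler_wpM2l.
have u0 : 0 <= x ^+ (2 * l.+1).+1 by rewrite exprn_ge0.
have v0 : 0 <= x ^+ (2 * l).+1 by rewrite exprn_ge0.
move: (x ^+ (2 * l.+1).+1) (x ^+ (2 * l).+1) u0 v0 => u v u0 v0.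
rewrite -natr1 -subr_ge0.
have -> : (C + K) * t * ((m%:R + 1) * u + (m%:R + 1) ^+ 2 * v)
 - ((C + K) * t * (m%:R * u + m%:R ^+ 2 * v) + C * (t * u) + K * (m%:R * t * v))
 = K * t * u + (C + K) * t * (m%:R + 1) * v + C * t * m%:R * v.
  by ring.
by rewrite !addr_ge0 // !mulr_ge0 ?addr_ge0.
Qed.

Definition comp_cov t k l n : R :=
  mom t (k + l) n + \sum_(m < n.+1) m%:R ^+ k * comp_mean (expR (- t)) n m * mom t l (n - m)
  - mom t k n * mom t l n.

(** Replacing the decrement of f_{l+1} by m times the slope turns the sum into the slope times a
    moment of order k + 1. Since division by x is multiplication by y, the subtracted product is
    likewise the slope times B_{k+1}. *)
Lemma comp_covE k l t n : subcritical t n ->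
  comp_cov t k.+1 l.+1 n - n%:R * ((borel_poly R (k + l).+1).[(gap t n)^-1]
     - (borel_poly R k.+1).[(gap t n)^-1] * (borel_poly R l.+1).[(gap t n)^-1] / (gap t n)^-1)
  = n%:R * moment_dev (k + l).+1 t n
    - sb_sum t n (fun m => m%:R ^+ k * (mom t l.+1 n - mom t l.+1 (n - m)
                                        - m%:R * (moment_slope l).[(gap t n)^-1]))
    - n%:R * ((moment_slope l).[(gap t n)^-1] * moment_dev k.+1 t n).
Proof.
move=> D; have [n0 t0 nt] := D; have y0 := gap_gt0 D.
have n0' : (n%:R : R) != 0 by rewrite pnatr_eq0 -lt0n.
rewrite -mulrA invrK [_.[_] * gap t n]mulrC horner_moment_slope //.
set r := (moment_slope l).[_].
have -> : comp_cov t k.+1 l.+1 n = sb_sum t n (fun m => m%:R ^+ (k + l).+1)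
    - sb_sum t n (fun m => m%:R ^+ k * (mom t l.+1 n - mom t l.+1 (n - m))).
  rewrite /comp_cov addSn addnS -!sb_sum_moment -addrA; congr (_ + _).
  rewrite mulr_suml -sumrB -sumrN; apply: eq_bigr => m _.
  by rewrite exprS; move: (m%:R ^+ k) => p; ring.
have -> : sb_sum t n (fun m => m%:R ^+ k * (mom t l.+1 n - mom t l.+1 (n - m) - m%:R * r))
   = sb_sum t n (fun m => m%:R ^+ k * (mom t l.+1 n - mom t l.+1 (n - m)))
     - r * sb_sum t n (fun m => m%:R ^+ k.+1).
  rewrite -mulNr -sb_sumZ -sb_sumD; apply: eq_bigr => m _.
  by rewrite exprS; move: (m%:R ^+ k) => p; ring.
by rewrite /moment_dev /sb_moment; field.
Qed.

Lemma comp_cov_asymptotics k l : (0 < l)%N -> exists2 C : R, 0 <= C &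
  forall t n, subcritical t n ->
  `|comp_cov t k.+1 l.+1 n - n%:R * ((borel_poly R (k + l).+1).[(gap t n)^-1]
     - (borel_poly R k.+1).[(gap t n)^-1] * (borel_poly R l.+1).[(gap t n)^-1] / (gap t n)^-1)|
  <= C * (n%:R * t * (gap t n)^-1 ^+ (2 * k.+1 + 2 * l.+1)).
Proof.
move=> l0; have [C1 C10 H1] := unif_bound_moment_dev R (k + l).+1.
have [C2 C20 H2] := moment_decrement l0.
have [C3 C30 H3] := sb_sum_pow_le R k; have [C4 C40 H4] := sb_sum_pow_le R k.+1.
have [C5 C50 H5] := horner_le (moment_slope l).
have [C6 C60 H6] := unif_bound_moment_dev R k.+1.
have s5 := size_moment_slope l0.
(* Every error comes out at the same power of x: the deviation of the joint moment by [e1], the two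
   decrement terms by [e2] and [e3], the slope times a deviation by [e4]. *)
have e1 : (2 * (k + l).+1).+2 = (2 * k.+1 + 2 * l.+1)%N by lia.
have e2 : (2 * k.+1 + 2 * l.+1 = (2 * l.+1).+1 + (2 * k).+1)%N by lia.
have e3 : (2 * k.+1 + 2 * l.+1 = (2 * l).+1 + (2 * k.+1).+1)%N by lia.
have e4 : (2 * k.+1 + 2 * l.+1 = (2 * l) + (2 * k.+1).+2)%N by lia.
exists (C1 + C2 * (C3 + C4) + C5 * C6).
  by rewrite !addr_ge0 // mulr_ge0 // addr_ge0.
move=> t n D; have [n0 t0 nt] := D; have y0 := gap_gt0 D; have x1 := gap_inv_ge1 D.
rewrite comp_covE //; set x := (gap t n)^-1 in x1 *.
have x0 : 0 <= x by rewrite (le_trans ler01).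
have n0' : 0 <= (n%:R : R) by [].
rewrite mulrDl; apply: le_trans (ler_normB _ _) _; apply: lerD; last first.
  rewrite normrM ger0_norm // normrM.
  rewrite (_ : C5 * C6 * _ = n%:R * ((C5 * x ^+ (2 * l)) * (C6 * (t * x ^+ (2 * k.+1).+2)))); last first.
    by rewrite e4 exprD; move: (x ^+ _) (x ^+ _) => a b; ring.
  rewrite ler_wpM2l //; apply: ler_pM => //; last exact: H6.
  apply: le_trans (H5 _ x1) _; rewrite ler_wpM2l //; apply: ler_weXn2l => //.
  by clear -s5; move: s5; case: (size _).
rewrite mulrDl; apply: le_trans (ler_normB _ _) _; apply: lerD.
  rewrite normrM ger0_norm // -[n%:R * t * _]mulrA mulrCA ler_wpM2l // mulrA -e1 -mulrA.
  exact: H1.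
apply: le_trans (sb_sum_norm _ _ t0) _.
apply: (@le_trans _ _ (sb_sum t n (fun m =>
   C2 * t * x ^+ (2 * l.+1).+1 * m%:R ^+ k.+1 + C2 * t * x ^+ (2 * l).+1 * m%:R ^+ k.+2))).
  apply: sb_sum_le => // m /andP[m0 mn].
  rewrite normrM ger0_norm ?exprn_ge0 //.
  apply: le_trans (ler_wpM2l _ (H2 t n m D mn)) _; first by rewrite exprn_ge0.
  rewrite -/x !exprS; move: (m%:R ^+ k) (x ^+ _) (x ^+ _) => p a b.
  by rewrite le_eqVlt; apply/orP; left; apply/eqP; ring.
rewrite sb_sumD !sb_sumZ.
have c1 : 0 <= C2 * t * x ^+ (2 * l.+1).+1 by apply: mulr_ge0; [apply: mulr_ge0 | apply: exprn_ge0].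
have c2 : 0 <= C2 * t * x ^+ (2 * l).+1 by apply: mulr_ge0; [apply: mulr_ge0 | apply: exprn_ge0].
apply: le_trans (lerD (ler_wpM2l c1 (H3 t n D)) (ler_wpM2l c2 (H4 t n D))) _.
rewrite -/x mulrDr mulrDl le_eqVlt; apply/orP; left; apply/eqP; congr (_ + _).
  by rewrite e2 exprD; move: (x ^+ (2 * k).+1) (x ^+ _) => a b; ring.
by rewrite e3 exprD; move: (x ^+ (2 * k.+1).+1) (x ^+ _) => a b; ring.
Qed.

End CovarianceAsymptotics.

Theorem theorem6p1 (R : realType) (k l : nat) (hk : (2 <= k)%N) (hl : (2 <= l)%N) :
  exists Pkl : {poly R},
    [/\ size Pkl = (2 * k + 2 * l - 3).+1%N,
        forall x : R, x != 0 ->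
          Pkl.[x] = (p_poly R (k + l)).[x]
                    - (p_poly R k.+1).[x] * (p_poly R l.+1).[x] / x
      & exists C : R,
        forall (n : nat) (d : measure_display) (Omega : measurableType d)
               (P : probability Omega R) (T : pair_of n -> {RV P >-> R}) (t : R),
          (1 <= n)%N -> exponential_clocks T -> 0 <= t -> t < n%:R^-1 ->
          (`| covariance P (S_process T k t) (S_process T l t)
              - (n%:R * Pkl.[(1 - n%:R * t)^-1])%:E |
           <= (C * (n%:R * t / (1 - n%:R * t) ^+ (2 * k + 2 * l)%N))%:E)%E ].
Proof.
exists (cov_poly R k l); split; first exact: size_cov_poly.
  move=> x x0; rewrite horner_cov_poly // !p_poly_borel; first by [].
  - exact: leqW hl.
  - exact: leqW hk.
  - exact: leq_trans hk (leq_addr _ _).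
(* Size-biasing absorbs one factor m, so the estimates are indexed by k - 1 and l - 1. *)
case: k hk => // k hk; case: l hl => // l hl.
have [C C0 HC] := comp_cov_asymptotics R k (l := l) hl.
exists C => n d Omega P T t n1 clocksT t0 tn.
have n0 : 0 < (n%:R : R) by rewrite ltr0n.
have D : subcritical t n by split=> //; rewrite mulrC -ltr_pdivlMr ?div1r.
have x0 : (gap t n)^-1 != 0 by rewrite invr_eq0 gt_eqF // gap_gt0.
rewrite (covariance_S_process clocksT t0 (ltn0Sn k) (ltn0Sn l)) -EFinB abse_EFin lee_fin.
have := HC t n D; rewrite /comp_cov -/(gap t n) horner_cov_poly //.
by rewrite addSn addnS /= exprVn.
Qed.
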